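(* Let $d,l_1,l_2,l_3>0$ be the link lengths of a planar four-bar mechanism. Say that dynamic balancing is possible in a given kinematic mode if there exist mass parameters $m_j>0$, $r_j\ge 0$, $p_j\in\mathbb{C}$ with $|p_j|=1$, and $I_j>0$ ($j=1,2,3$) such that the mechanism with these link lengths and mass parameters is dynamically balanced in that mode. The static and dynamic balancing conditions are the following. (1) Suppose $l_1=l_2$ and $l_3=d$. In the mode $z_1\neq z_2$, the mechanism is statically balanced if and only if $F_1=F_2=0$, and dynamic balancing is possible if and only if $d\ge\sqrt{2}\,l_2$. In the mode $z_1=z_2$, the mechanism is statically balanced if and only if $F_1+F_2=0$, and dynamic balancing is not possible. (2) Suppose $l_1=d$ and $l_2=l_3$. In the mode $z_1\neq 1$, the mechanism is statically balanced if and only if $F_1=F_2=0$, and dynamic balancing is possible if and only if $d\ge\sqrt{2}\,l_3$. In the mode $z_1=1$, the mechanism is statically balanced if and only if $F_2=0$, and dynamic balancing is not possible. (3) Suppose $l_2=d$ and $l_1=l_3$. In the mode $z_2\neq -1$, the mechanism is statically balanced if and only if $F_1=F_2=0$, and dynamic balancing is possible if and only if $d\ge\sqrt{2}\,l_3$. In the mode $z_2=-1$, the mechanism is statically balanced if and only if $F_1=0$, and dynamic balancing is not possible. (4) Otherwise, that is, if none of the three pairs of equalities in (1), (2), (3) holds, the mechanism is statically balanced if and only if $F_1=F_2=0$, and dynamic balancing is not possible: for no choice of mass parameters is the mechanism dynamically balanced on any infinite set of configurations.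
   Context: Kinematics. A planar four-bar mechanism has a fixed base of length $d>0$ and three moving links of lengths $l_1,l_2,l_3>0$. In the complex plane, link 1 runs from $0$ to $l_1z_1$, link 2 from $d$ to $d+l_2z_2$, and link 3 (the coupler) from $l_1z_1$ to $l_1z_1+l_3z_3=d+l_2z_2$, where $z_j=e^{i\theta_j}$ are unit complex numbers. Put $G_1=-l_1/l_3$, $G_2=l_2/l_3$, $G_3=d/l_3$, so $z_3=G_1z_1+G_2z_2+G_3$. A configuration is a pair $(z_1,z_2)$ of unit complex numbers with $$G(z_1,z_2)=(G_1z_1+G_2z_2+G_3)(G_1z_1^{-1}+G_2z_2^{-1}+G_3)-1=0.$$ Differentiating $G=0$ in time gives $i(K_1\dot\theta_1+K_2\dot\theta_2)=0$ with $$K_1=G_1G_2(z_1z_2^{-1}-z_1^{-1}z_2)+G_1G_3(z_1-z_1^{-1}),\qquad K_2=G_1G_2(z_1^{-1}z_2-z_1z_2^{-1})+G_2G_3(z_2-z_2^{-1}).$$ Mass parameters. Link $j$ has mass $m_j>0$, moment of inertia $I_j>0$ about its centre of mass, and centre of mass at (starting point of the link) $+\,r_jp_jz_j$, with $r_j\ge0$ and $|p_j|=1$; the starting points are $0$, $d$, $l_1z_1$ for $j=1,2,3$. Put $J_j=I_j+m_jr_j^2$. Centre of mass. The total centre of mass is $\frac{1}{m_1+m_2+m_3}(F_1z_1+F_2z_2+F_3)$ with $F_1=m_1r_1p_1+m_3l_1+G_1m_3r_3p_3$, $F_2=m_2r_2p_2+G_2m_3r_3p_3$, $F_3=m_2d+G_3m_3r_3p_3$.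 Angular momentum. With $\langle a,b\rangle=\mathrm{Re}(a\bar b)$, the total angular momentum is $$H=J_1\dot\theta_1+\big(\langle d,m_2r_2p_2z_2\rangle+J_2\big)\dot\theta_2+\langle l_1z_1+r_3p_3z_3,\ m_3(l_1z_1\dot\theta_1+r_3p_3z_3\dot\theta_3)\rangle+I_3\dot\theta_3.$$ Substituting $z_3=G_1z_1+G_2z_2+G_3$, $z_3\dot\theta_3=G_1z_1\dot\theta_1+G_2z_2\dot\theta_2$ and $\dot\theta_3=\langle z_3,z_3\dot\theta_3\rangle$ gives $H=K_3\dot\theta_1+K_4\dot\theta_2$, where $K_3,K_4$ are functions of $(z_1,z_2)$. Put $K=K_1K_4-K_2K_3$. Balancing. The mechanism is statically balanced on an infinite set $S$ of configurations (a non-constant trajectory) if $F_1z_1+F_2z_2$ is constant on $S$ (the centre of mass is stationary). It is dynamically balanced on $S$ if it is statically balanced on $S$ and moreover $K(z_1,z_2)=0$ for all $(z_1,z_2)\in S$ (the angular momentum vanishes). It is statically (respectively dynamically) balanced in the mode $z_1\ne z_2$ (or $z_1=z_2$, $z_1\ne1$, $z_1=1$, $z_2\neq-1$, $z_2=-1$) if it is so on an infinite set $S$ of configurations all of which satisfy that relation; when no mode is specified, $S$ is any infinite set of configurations. The modes correspond to the components of the curve $G=0$ when $G$ is a reducible Laurent polynomial.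
   Formalization: The bounds d≥√2·l in (1)–(3) are false at equality and become d>√2·l; for the rhombus l1=l2=l3=d the static claim in modes z1≠z2, z1≠1, z2≠-1 fails for some infinite S, so there it is stated only for balancing on all configurations of the mode. *)

(* Defs.v *)
From HB Require Import structures.
From mathcomp Require Import all_boot all_order all_algebra.
From mathcomp Require Import complex.
From mathcomp Require Import all_classical all_reals.
From mathcomp Require Import ring.

Set Implicit Arguments.
Unset Strict Implicit.
Unset Printing Implicit Defensive.

Import Order.TTheory GRing.Theory Num.Theory.
Local Open Scope classical_set_scope.
Local Open Scope ring_scope.
Local Open Scope complex_scope.

(* Fixed base [base L] = d; [len1 L], [len2 L], [len3 L] are l_1, l_2, l_3,
   link 3 being the coupler. *)
Record linkage (R : realType) :=
  Linkage { base : R; len1 : R; len2 : R; len3 : R }.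

(* The centre of mass of a link is at (starting point) + offset * dir * z_j;
   [inertia] is taken about the centre of mass. *)
Record link_mass (R : realType) :=
  LinkMass { mass : R; inertia : R; offset : R; dir : R[i] }.

Record masses (R : realType) := Masses
  { link1 : link_mass R; link2 : link_mass R; link3 : link_mass R }.

Definition admissible_link (R : realType) (p : link_mass R) : Prop :=
  [/\ 0 < mass p, 0 < inertia p, 0 <= offset p & `|dir p| = 1].

Definition admissible (R : realType) (M : masses R) : Prop :=
  [/\ admissible_link (link1 M), admissible_link (link2 M)
    & admissible_link (link3 M)].

(* J_j = I_j + m_j r_j^2 *)
Definition Jmom (R : realType) (p : link_mass R) : R :=
  inertia p + mass p * offset p ^+ 2.

(* <a, b> = Re (a * conj b) *)
Definition dotc (R : realType) (a b : R[i]) : R := complex.Re (a * (b^*)%C).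

Section Kinematics.
Context (R : realType) (L : linkage R).

Definition G1 : R[i] := (- (len1 L / len3 L))%:C.
Definition G2 : R[i] := (len2 L / len3 L)%:C.
Definition G3 : R[i] := (base L / len3 L)%:C.

Definition coupler (z1 z2 : R[i]) : R[i] := G1 * z1 + G2 * z2 + G3.

Definition Gfun (z1 z2 : R[i]) : R[i] :=
  (G1 * z1 + G2 * z2 + G3) * (G1 * z1^-1 + G2 * z2^-1 + G3) - 1.

Definition K1 (z1 z2 : R[i]) : R[i] :=
  G1 * G2 * (z1 * z2^-1 - z1^-1 * z2) + G1 * G3 * (z1 - z1^-1).

Definition K2 (z1 z2 : R[i]) : R[i] :=
  G1 * G2 * (z1^-1 * z2 - z1 * z2^-1) + G2 * G3 * (z2 - z2^-1).

Definition configuration (z : R[i] * R[i]) : Prop :=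
  [/\ `|z.1| = 1, `|z.2| = 1 & Gfun z.1 z.2 = 0].

Definition mode_configs (mode : set (R[i] * R[i])) : set (R[i] * R[i]) :=
  [set z | configuration z /\ mode z].

(* An infinite set of configurations, all of them in the given mode. *)
Definition trajectory (mode S : set (R[i] * R[i])) : Prop :=
  infinite_set S /\ S `<=` mode_configs mode.

(* For a rhombus the curve G = 0 has the three components z1 = z2, z1 = 1 and
   z2 = -1, so each of the modes z1 <> z2, z1 <> 1, z2 <> -1 is then a union of
   two components rather than a single one. *)
Definition rhombus : Prop :=
  [/\ len1 L = base L, len2 L = base L & len3 L = base L].

End Kinematics.

(* When the mode is left unspecified, [setT] is used. *)
Section Modes.
Context {R : realType}.
Local Notation C := R[i].

Definition z1_neq_z2 : set (C * C) := [set z | z.1 <> z.2].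
Definition z1_eq_z2 : set (C * C) := [set z | z.1 = z.2].
Definition z1_neq_1 : set (C * C) := [set z | z.1 <> 1].
Definition z1_eq_1 : set (C * C) := [set z | z.1 = 1].
Definition z2_neq_N1 : set (C * C) := [set z | z.2 <> -1].
Definition z2_eq_N1 : set (C * C) := [set z | z.2 = -1].

End Modes.

Section Dynamics.
Context (R : realType) (L : linkage R) (M : masses R).

Let m1 := mass (link1 M).
Let m2 := mass (link2 M).
Let m3 := mass (link3 M).
Let r1 := offset (link1 M).
Let r2 := offset (link2 M).
Let r3 := offset (link3 M).
Let p1 := dir (link1 M).
Let p2 := dir (link2 M).
Let p3 := dir (link3 M).

Definition F1 : R[i] :=
  (m1 * r1)%:C * p1 + (m3 * len1 L)%:C + G1 L * (m3 * r3)%:C * p3.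

Definition F2 : R[i] := (m2 * r2)%:C * p2 + G2 L * (m3 * r3)%:C * p3.

(* Angular momentum as a function of the position (z1, z2) and of the angular
   velocities w1, w2 of links 1 and 2.  Here v = z_3 * w3 is obtained by
   differentiating z_3 = G_1 z_1 + G_2 z_2 + G_3, and w3 = <z_3, v>, the
   angular velocity of the coupler, is then determined since |z_3| = 1. *)
Definition angmom (z1 z2 : R[i]) (w1 w2 : R) : R :=
  let z3 := coupler L z1 z2 in
  let v := G1 L * z1 * w1%:C + G2 L * z2 * w2%:C in
  let w3 := dotc z3 v in
  Jmom (link1 M) * w1
  + (dotc (base L)%:C ((m2 * r2)%:C * p2 * z2) + Jmom (link2 M)) * w2
  + dotc ((len1 L)%:C * z1 + r3%:C * p3 * z3)
         (m3%:C * ((len1 L)%:C * z1 * w1%:C + r3%:C * p3 * v))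
  + inertia (link3 M) * w3.

(* K_3 and K_4 are the coefficients of w1 and w2 in the angular momentum, see
   [angmomE] below. *)
Definition K3 (z1 z2 : R[i]) : R := angmom z1 z2 1 0.
Definition K4 (z1 z2 : R[i]) : R := angmom z1 z2 0 1.

Definition K (z1 z2 : R[i]) : R[i] :=
  K1 L z1 z2 * (K4 z1 z2)%:C - K2 L z1 z2 * (K3 z1 z2)%:C.

(* The total centre of mass is (F_1 z_1 + F_2 z_2 + F_3) / (m_1 + m_2 + m_3),
   so it is stationary when F_1 z_1 + F_2 z_2 is constant. *)
Definition statically_balanced_on (S : set (R[i] * R[i])) : Prop :=
  exists c : R[i], forall z, S z -> F1 * z.1 + F2 * z.2 = c.

Definition dynamically_balanced_on (S : set (R[i] * R[i])) : Prop :=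
  statically_balanced_on S /\ forall z, S z -> K z.1 z.2 = 0.

Definition statically_balanced (mode : set (R[i] * R[i])) : Prop :=
  exists S, trajectory L mode S /\ statically_balanced_on S.

Definition dynamically_balanced (mode : set (R[i] * R[i])) : Prop :=
  exists S, trajectory L mode S /\ dynamically_balanced_on S.

End Dynamics.

Definition dynamic_balancing_possible (R : realType) (L : linkage R)
    (mode : set (R[i] * R[i])) : Prop :=
  exists M : masses R, admissible M /\ dynamically_balanced L M mode.

Section AngularMomentumLinear.
Context (R : realType).

Lemma dotcDr (a b c : R[i]) : dotc a (b + c) = dotc a b + dotc a c.
Proof. by rewrite /dotc rmorphD mulrDr raddfD. Qed.

Lemma dotcZr (a b : R[i]) (x : R) : dotc a (b * x%:C) = dotc a b * x.
Proof.
case: a b => [a1 a2] [b1 b2]; rewrite /dotc /= !(mulr0, mul0r, addr0, subr0).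
by rewrite add0r !mulrN !opprK mulrDl !mulrA.
Qed.

Lemma angmomE (L : linkage R) (M : masses R) (z1 z2 : R[i]) (w1 w2 : R) :
  angmom L M z1 z2 w1 w2 = K3 L M z1 z2 * w1 + K4 L M z1 z2 * w2.
Proof.
rewrite /K3 /K4 /angmom /= !rmorph1 !rmorph0 !(mulr1, mulr0, addr0, add0r).
by rewrite !(mulrDr, dotcDr, mulrA, dotcZr); ring.
Qed.

End AngularMomentumLinear.

(* Main.v *)
Require Import Defs.
From mathcomp Require Import all_boot all_order all_algebra.
From mathcomp Require Import complex.
From mathcomp Require Import all_classical all_reals.
From mathcomp Require Import ring lra.
Import Order.TTheory GRing.Theory Num.Theory.
Local Open Scope classical_set_scope.
Local Open Scope ring_scope.
Local Open Scope complex_scope.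

(* Statics: on infinitely many configurations a relation F_1 z_1 + F_2 z_2 = c
   makes one of z_1, z_2, z_2 / z_1 constant unless F_1 = F_2 = 0, and the
   coefficients of the Laurent polynomial G then force one of the three
   degenerate components.

   Dynamics: let F_1 = F_2 = 0 and let c be the real part of G_2 z_2 / z_3, an
   affine function of Re z_1 by the law of cosines.  Up to a nonzero factor, the
   angular momentum is a combination of 1, e, k and e k with coefficients
   polynomial in c, where e = G_1 G_3 Im z_1 and k = k_2 = K_2 / 2i satisfy
   e^2 = E(c) and k^2 = G_2^2 - c^2 for a quadratic polynomial E.  If none of
   E(c), G_2^2 - c^2 and their product is a square, the four coefficients vanish
   separately; this is possible only if l_1 = d and l_2 = l_3.  The product is a
   square exactly when l_1 = l_2, l_3 = d or l_2 = d, l_1 = l_3; then e = k or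
   e = - k on each component.  The resulting linear conditions on the moments of
   inertia have positive solutions exactly under the stated inequalities. *)

(** Of a trajectory only infinitude is known, so every identity is reduced to a polynomial in one
    coordinate with too many roots. Independence of the square roots is certified by simple roots:
    if q has a root of multiplicity one, then p^2 = r^2 q forces p = r = 0 by parity. The nonzero
    factor in the angular momentum is the squared length of the diagonal D = G_1 z_1 + G_3; it
    clears the denominators that arise when k_1 and w_3 are expressed through c, e and k_2. It
    vanishes only for l_1 = d and z_1 = 1, which matters when the balance equations are shown to be
    sufficient. The final inequalities are strict: with all I_j > 0 no admissible masses exist when
    d is exactly sqrt 2 times the other length. The rhombus satisfies all three pairs of equalities
    at once and is treated separately, because the moving factor of G splits there once more. *)

(** * Polynomial relations on infinite sets *)

(** S is covered by the fibres over the finitely many roots of p, so one of them is infinite. The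
    conclusion is a fibre and not p = 0 because f may be constant on S, which is what happens on the
    degenerate components. *)
Lemma infinite_fiber (T : Type) (F : fieldType) (S : set T) (f : T -> F)
    (p : {poly F}) :
  infinite_set S -> p != 0 -> (forall z, S z -> p.[f z] = 0) ->
  exists r, infinite_set (S `&` f @^-1` [set r]).
Proof.
move=> infS p0 pS; apply: contrapT => nofib; apply: infS.
have finr r : finite_set (S `&` f @^-1` [set r]).
  by apply: contrapT => H; apply: nofib; exists r.
have [r _ roots] : exists2 s : seq F, True & forall x, root p x -> x \in s.
  elim: {p}(size p) {-2}p (leqnn (size p)) p0 {pS} => [|n IH] p.
    by rewrite leqn0 size_poly_eq0 => ->.
  move=> sp p0; have [[x px]|nr] := pselect (exists x, root p x); last first.
    by exists [::] => // x px; case: nr; exists x.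
  have /factor_theorem [q pE] := px.
  have q0 : q != 0 by apply: contra_neq p0 => q0; rewrite pE q0 mul0r.
  have [|s _ sP] := IH q _ q0.
    by move: sp; rewrite pE size_Mmonic ?monicXsubC// size_XsubC addn2.
  exists (x :: s) => // y; rewrite pE rootM root_XsubC inE.
  by case/orP => [/sP ->|->]; rewrite ?orbT.
apply: (@sub_finite_set _ _ (\bigcup_(x in [set` r]) (S `&` f @^-1` [set x]))).
  move=> z Sz; exists (f z) => //=; apply: roots; exact/rootP/pS.
apply: bigcup_finite => //; exact: finite_seq.
Qed.

(* The multiplicity of the root [x] is even on the left, odd on the right. *)
Lemma mul_sqr_eq_sqr_eq0 (F : fieldType) (p r q : {poly F}) (x : F) :
  ~~ root q x -> p ^+ 2 = r ^+ 2 * (('X - x%:P) * q) -> p = 0 /\ r = 0.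
Proof.
move=> qx pr; have q0 : q != 0 by apply: contraNneq qx => ->; rewrite root0.
have X0 : 'X - x%:P != 0 by rewrite polyXsubC_eq0.
have [r0|r0] := eqVneq r 0.
  by move: pr; rewrite r0 expr0n mul0r => /eqP; rewrite expf_eq0 => /eqP ->.
have [p0|p0] := eqVneq p 0.
  move/esym/eqP: pr; rewrite p0 expr0n !mulf_eq0 (negPf q0) (negPf X0) !orbF.
  by rewrite orbb (negPf r0).
move/(congr1 (mup x)): pr; rewrite !expr2 !mupM ?mulf_neq0// (mupNroot qx).
rewrite -['X - _]expr1 mup_XsubCX eqxx addn0 !addnn addn1 => /(congr1 odd).
by rewrite /= !odd_double.
Qed.

(* The norm form of [p0 + p1 sqrt E + p2 sqrt K + p3 sqrt (E K)], written so
   that the four coefficients may be separated when none of [E], [K], [E K] is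
   a square. *)
Lemma biquadratic_norm_eq0 (F : fieldType) (p0 p1 p2 p3 E E' K K' M : {poly F})
    (x y z : F) :
  E = ('X - x%:P) * E' -> ~~ root E' x ->
  K = ('X - y%:P) * K' -> ~~ root K' y ->
  E * K = ('X - z%:P) * M -> ~~ root M z -> (2 : F) != 0 ->
  (p0 ^+ 2 + p1 ^+ 2 * E - (p2 ^+ 2 + p3 ^+ 2 * E) * K) ^+ 2 =
    (2 *: (p2 * p3 * K - p0 * p1)) ^+ 2 * E ->
  [/\ p0 = 0, p1 = 0, p2 = 0 & p3 = 0].
Proof.
move=> hE nE hK nK hM nM n2 h.
(* The hypothesis reads A^2 = B^2 E with x a simple root of E, so A = B = 0. *)
have [h1 /eqP h2] : p0 ^+ 2 + p1 ^+ 2 * E - (p2 ^+ 2 + p3 ^+ 2 * E) * K = 0 /\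
  2 *: (p2 * p3 * K - p0 * p1) = 0.
  by apply: (@mul_sqr_eq_sqr_eq0 _ _ _ E' x nE); rewrite -hE.
move: h2; rewrite scaler_eq0 (negPf n2) subr_eq0 => /eqP h2.
have sq0 (p q : {poly F}) : p = 0 -> p ^+ 2 = q ^+ 2 -> q = 0.
  by move=> -> /esym/eqP; rewrite expr0n sqrf_eq0 => /eqP.
(* Multiplying A = 0 by p1^2 and using p0 p1 = p2 p3 K makes it factor. *)
have : (p1 ^+ 2 * E - p2 ^+ 2 * K) * (p1 ^+ 2 - p3 ^+ 2 * K) = 0.
  have : p1 ^+ 2 * (p0 ^+ 2 + p1 ^+ 2 * E - (p2 ^+ 2 + p3 ^+ 2 * E) * K) = 0.
    by rewrite h1 mulr0.
  rewrite [LHS](_ : _ = (p0 * p1) ^+ 2 + p1 ^+ 4 * E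
     - p1 ^+ 2 * (p2 ^+ 2 + p3 ^+ 2 * E) * K); last by ring.
  by rewrite -h2 => <-; ring.
move/eqP; rewrite mulf_eq0 !subr_eq0 => /orP[]/eqP h3.
  (* Here p1^2 E = p2^2 K, that is (p2 K)^2 = p1^2 E K, and z is a simple root of E K. *)
  have [] : p2 * K = 0 /\ p1 = 0.
    apply: (@mul_sqr_eq_sqr_eq0 _ _ _ M z nM).
    by rewrite -hM exprMn expr2 [X in _ * X]expr2 mulrA mulrA -h3; ring.
  move=> /eqP; rewrite mulf_eq0 => /orP[/eqP p20 p10|/eqP K0]; last first.
    by move: nM; rewrite (_ : M = 0) ?root0//; move/esym/eqP: hM;
       rewrite K0 mulr0 mulf_eq0 polyXsubC_eq0 => /eqP.
  have [p00 p30] : p0 = 0 /\ p3 = 0.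
    apply: (@mul_sqr_eq_sqr_eq0 _ _ _ M z nM); rewrite -hM; apply/eqP.
    by rewrite -subr_eq0 -h1 p10 p20; apply/eqP; ring.
  by [].
have [p10 p30] : p1 = 0 /\ p3 = 0.
  by apply: (@mul_sqr_eq_sqr_eq0 _ _ _ K' y nK); rewrite -hK.
have [p00 p20] : p0 = 0 /\ p2 = 0.
  apply: (@mul_sqr_eq_sqr_eq0 _ _ _ K' y nK); rewrite -hK; apply/eqP.
  by rewrite -subr_eq0 -h1 p10 p30; apply/eqP; ring.
by [].
Qed.

(** * Static balancing *)

Lemma unit_neq0 (R : realType) (z : R[i]) : `|z| = 1 -> z != 0.
Proof. by move=> z1; rewrite -normr_gt0 z1. Qed.

Lemma unit_conj (R : realType) (z : R[i]) : `|z| = 1 -> (z^*)%C = z^-1.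
Proof. by move=> z1; rewrite invc_norm z1 expr1n invr1 mul1r. Qed.

Lemma unit_real_pos (R : realType) (x : R) : `|x%:C| = 1 -> 0 < x -> x = 1.
Proof.
rewrite normc_def /= expr0n addr0 sqrtr_sqr => + x0; rewrite gtr0_norm// => h.
by move/(congr1 (@complex.Re R)): h.
Qed.

Lemma ratio_norm1 (R : realType) (x y : R) :
  0 < x -> 0 < y -> `|(x / y)%:C| = 1 -> x = y.
Proof.
move=> x0 y0 /unit_real_pos xy; rewrite -[LHS](divfK (lt0r_neq0 y0)).
by rewrite xy ?mul1r// divr_gt0.
Qed.

Lemma ratio_sqr1 (R : realType) (x y : R) :
  0 < x -> 0 < y -> ((x / y)%:C) ^+ 2 = 1 -> x = y.
Proof.
move=> x0 y0; rewrite -rmorphXn => /complexI /= /eqP.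
rewrite sqrf_eq1 => /orP[/eqP h|/eqP h].
  by rewrite -[LHS](divfK (lt0r_neq0 y0)) h mul1r.
by have := divr_gt0 x0 y0; rewrite h ltr0N1.
Qed.

Lemma infinite_image (T U : Type) (S : set T) (f : T -> U) :
  {in S &, injective f} -> infinite_set S -> infinite_set (f @` S).
Proof.
move=> fI; apply: contra_not => fin.
by rewrite -(eq_finite_set (inj_card_eq fI)).
Qed.

Lemma quadratic_eq0 (T : Type) (F : fieldType) (S : set T) (f : T -> F)
    (a b c : F) :
  infinite_set S -> (forall z, S z -> a * f z ^+ 2 + b * f z + c = 0) ->
  (forall r, finite_set (S `&` f @^-1` [set r])) -> [/\ a = 0, b = 0 & c = 0].
Proof.
move=> infS h fin; set p : {poly F} := Poly [:: c; b; a].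
have p0 : p = 0.
  apply: contrapT => /eqP p0.
  have [z Sz|r] := @infinite_fiber _ _ S f p infS p0; last exact.
  by rewrite horner_Poly /= mul0r add0r -(h z Sz); ring.
have coef i : [:: c; b; a]`_i = 0 by rewrite -coef_Poly -/p p0 coef0.
by split; [apply: (coef 2%N)|apply: (coef 1%N)|apply: (coef 0%N)].
Qed.

Lemma finite_fst_snd (T U : Type) (S : set (T * U)) x y :
  (forall z, S z -> z.1 = x) -> finite_set (S `&` snd @^-1` [set y]).
Proof.
move=> h; apply: (@sub_finite_set _ _ [set (x, y)]); last exact: finite_set1.
by move=> [a b] [/h/= -> /= ->].
Qed.

Lemma finite_snd_fst (T U : Type) (S : set (T * U)) x y :
  (forall z, S z -> z.2 = y) -> finite_set (S `&` fst @^-1` [set x]).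
Proof.
move=> h; apply: (@sub_finite_set _ _ [set (x, y)]); last exact: finite_set1.
by move=> [a b] [/h/= -> /= ->].
Qed.

Section Static.
Context (R : realType) (d l1 l2 l3 : R).
Context (hd : 0 < d) (hl1 : 0 < l1) (hl2 : 0 < l2) (hl3 : 0 < l3).
Let L := Linkage d l1 l2 l3.

Lemma config_laurent z : configuration L z ->
  G1 L ^+ 2 + G2 L ^+ 2 + G3 L ^+ 2 - 1
  + G1 L * G2 L * (z.1 / z.2 + z.2 / z.1) + G1 L * G3 L * (z.1 + z.1^-1)
  + G2 L * G3 L * (z.2 + z.2^-1) = 0.
Proof.
case: z => z1 z2 [/= /unit_neq0 n1 /unit_neq0 n2 <-]; rewrite /Gfun.
by move: (G1 L) (G2 L) (G3 L) => g1 g2 g3; field; rewrite n1 n2.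
Qed.

Lemma G1_lt0 : - (l1 / l3) < 0. Proof. by rewrite oppr_lt0 divr_gt0. Qed.
Lemma G2_gt0 : 0 < l2 / l3. Proof. by rewrite divr_gt0. Qed.
Lemma G3_gt0 : 0 < d / l3. Proof. by rewrite divr_gt0. Qed.

Lemma G_neq0 : [/\ G1 L != 0, G2 L != 0 & G3 L != 0].
Proof.
by rewrite /G1 /G2 /G3 !fmorph_eq0 /=; split; [rewrite lt_eqF ?G1_lt0 | rewrite gt_eqF ?G2_gt0
  | rewrite gt_eqF ?G3_gt0].
Qed.

(** After multiplication by z_2, the equation G = 0 at z_1 = r is a quadratic in z_2 with infinitely
    many roots. Its outer coefficients give r = - G_3 / G_1 = d / l_1, a positive number of modulus
    one; the middle coefficient is then G_2^2 - 1. *)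
Lemma infinite_fst_const S r : trajectory L setT S ->
  (forall z, S z -> z.1 = r) -> [/\ l1 = d, l2 = l3 & r = 1].
Proof.
move=> [infS Sc] Sr; have [n1 n2 n3] := G_neq0.
have r1 : `|r| = 1.
  by have [z Sz] := infinite_setN0 infS; rewrite -(Sr z Sz); have [[]] := Sc z Sz.
have r0 := unit_neq0 _ _ r1.
pose b := G1 L ^+ 2 + G2 L ^+ 2 + G3 L ^+ 2 - 1 + G1 L * G3 L * (r + r^-1).
have [|y|h1 h2 h3] := @quadratic_eq0 _ _ S snd
    (G1 L * G2 L / r + G2 L * G3 L) b (G1 L * G2 L * r + G2 L * G3 L) infS.
- move=> z Sz; have [cz _] := Sc z Sz; have := config_laurent _ cz.
  case: cz => _ /unit_neq0 n _ /(congr1 (fun x => x * z.2)); rewrite mul0r => <-.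
  rewrite /b (Sr z Sz); move: (G1 L) (G2 L) (G3 L) => g1 g2 g3.
  by field; rewrite r0 n.
- exact: finite_fst_snd Sr.
have rE : r = (d / l1)%:C.
  have {}h3 : G1 L * r + G3 L = 0.
    by apply: (mulfI n2); rewrite mulr0 -h3; ring.
  have -> : r = - G3 L / G1 L.
    apply: (mulfI n1); apply: (addIr (G3 L)); rewrite h3.
    by rewrite mulrCA divff// mulr1 addNr.
  rewrite -rmorphN -fmorphV -rmorphM /=; congr _%:C; field.
  by rewrite !gt_eqF.
have dl1 : d = l1 by apply: ratio_norm1; rewrite -?rE.
have {}rE : r = 1 by rewrite rE dl1 divff// gt_eqF.
split=> //; apply: ratio_sqr1 => //; move: h2; rewrite /b rE /G1 /G2 /G3 /L /= dl1.
rewrite rmorphN /= => h2; apply/eqP; rewrite -subr_eq0 -h2 invr1; apply/eqP.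
by move: _%:C _%:C => x y; ring.
Qed.

(** The same argument in z_1, but now r = - G_3 / G_2 = - d / l_2 is negative: this is why the
    degenerate value is -1. *)
Lemma infinite_snd_const S r : trajectory L setT S ->
  (forall z, S z -> z.2 = r) -> [/\ l2 = d, l1 = l3 & r = -1].
Proof.
move=> [infS Sc] Sr; have [n1 n2 n3] := G_neq0.
have r1 : `|r| = 1.
  by have [z Sz] := infinite_setN0 infS; rewrite -(Sr z Sz); have [[]] := Sc z Sz.
have r0 := unit_neq0 _ _ r1.
pose b := G1 L ^+ 2 + G2 L ^+ 2 + G3 L ^+ 2 - 1 + G2 L * G3 L * (r + r^-1).
have [|y|h1 h2 h3] := @quadratic_eq0 _ _ S fst
    (G1 L * G2 L / r + G1 L * G3 L) b (G1 L * G2 L * r + G1 L * G3 L) infS.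
- move=> z Sz; have [cz _] := Sc z Sz; have := config_laurent _ cz.
  case: cz => /unit_neq0 n _ _ /(congr1 (fun x => x * z.1)); rewrite mul0r => <-.
  rewrite /b (Sr z Sz); move: (G1 L) (G2 L) (G3 L) => g1 g2 g3.
  by field; rewrite r0 n.
- exact: finite_snd_fst Sr.
have rE : r = - (d / l2)%:C.
  have {}h3 : G2 L * r + G3 L = 0.
    by apply: (mulfI n1); rewrite mulr0 -h3; ring.
  have -> : r = - (G3 L / G2 L).
    apply: (mulfI n2); apply: (addIr (G3 L)); rewrite h3.
    by rewrite mulrN mulrCA divff// mulr1 addNr.
  rewrite -fmorphV -rmorphM /=; congr (- _%:C); field.
  by rewrite !gt_eqF.
have dl2 : d = l2 by apply: ratio_norm1; rewrite // -normrN -rE.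
have {}rE : r = -1 by rewrite rE dl2 divff// gt_eqF.
split=> //; apply: ratio_sqr1 => //; move: h2; rewrite /b rE /G1 /G2 /G3 /L /= dl2.
rewrite rmorphN /= => h2; apply/eqP; rewrite -subr_eq0 -h2 invrN1; apply/eqP.
by move: _%:C _%:C => x y; ring.
Qed.

(** With z_2 = u z_1 the equation is quadratic in z_1; it gives u = - G_1 / G_2 = l_1 / l_2 > 0, and
    the middle coefficient becomes G_3^2 - 1. *)
Lemma infinite_ratio_const S u : trajectory L setT S -> u != 0 ->
  (forall z, S z -> z.2 = u * z.1) -> [/\ l1 = l2, l3 = d & u = 1].
Proof.
move=> tS u0 Sr; have [infS Sc] := tS; have [n1 n2 n3] := G_neq0.
have u1 : `|u| = 1.
  have [z Sz] := infinite_setN0 infS; have [[z1 + _] _] := Sc z Sz.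
  by rewrite (Sr z Sz) normrM z1 mulr1.
pose b := G1 L ^+ 2 + G2 L ^+ 2 + G3 L ^+ 2 - 1 + G1 L * G2 L * (u + u^-1).
have [|y|h1 h2 h3] := @quadratic_eq0 _ _ S fst
    (G1 L * G3 L + G2 L * G3 L * u) b (G1 L * G3 L + G2 L * G3 L / u) infS.
- move=> z Sz; have [cz _] := Sc z Sz; have := config_laurent _ cz.
  case: cz => /unit_neq0 n _ _ /(congr1 (fun x => x * z.1)); rewrite mul0r => <-.
  rewrite /b (Sr z Sz); move: (G1 L) (G2 L) (G3 L) => g1 g2 g3.
  by field; rewrite n u0.
- apply: (@sub_finite_set _ _ [set (y, u * y)]); last exact: finite_set1.
  by move=> [a c] [/Sr/= -> /= ->].
have uE : u = (l1 / l2)%:C.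
  have {}h1 : G2 L * u + G1 L = 0.
    by apply: (mulfI n3); rewrite mulr0 -h1; ring.
  have -> : u = - (G1 L / G2 L).
    apply: (mulfI n2); apply: (addIr (G1 L)); rewrite h1.
    by rewrite mulrN mulrCA divff// mulr1 addNr.
  rewrite -fmorphV -rmorphM -rmorphN /=; congr _%:C; field.
  by rewrite !gt_eqF.
have l12 : l1 = l2 by apply: ratio_norm1; rewrite // -uE.
have {}uE : u = 1 by rewrite uE l12 divff// gt_eqF.
split=> //; apply/esym/ratio_sqr1 => //.
move: h2; rewrite /b uE /G1 /G2 /G3 /L /= l12.
rewrite rmorphN /= => h2; apply/eqP; rewrite -subr_eq0 -h2 invr1; apply/eqP.
by move: _%:C _%:C => x y; ring.
Qed.

(* If A and B are nonzero, eliminating z_2 between the relation and its complex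
   conjugate leaves a quadratic equation for z_1, whence c = 0. *)
Lemma static_linear_relation (A B c : R[i]) S : trajectory L setT S ->
  (forall z, S z -> A * z.1 + B * z.2 = c) ->
  [\/ A = 0 /\ B = 0,
      [/\ l1 = l2, l3 = d, A + B = 0 & forall z, S z -> z.1 = z.2],
      [/\ l1 = d, l2 = l3, B = 0 & forall z, S z -> z.1 = 1] |
      [/\ l2 = d, l1 = l3, A = 0 & forall z, S z -> z.2 = -1]].
Proof.
move=> tS h; have [infS Sc] := tS.
have [A0|A0] := eqVneq A 0; have [B0|B0] := eqVneq B 0; first by constructor 1.
- have zB z : S z -> z.2 = c / B.
    by move/h; rewrite A0 mul0r add0r => <-; rewrite mulrC mulKf.
  by have [? ? e] := infinite_snd_const _ _ tS zB; rewrite e in zB; constructor 4.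
- have zA z : S z -> z.1 = c / A.
    by move/h; rewrite B0 mul0r addr0 => <-; rewrite mulrC mulKf.
  by have [? ? e] := infinite_fst_const _ _ tS zA; rewrite e in zA; constructor 3.
have zB z : S z -> z.2 = (c - A * z.1) / B.
  by move/h => <-; rewrite addrC addKr mulrC mulKf.
have [|y|/eqP h1 _ _] := @quadratic_eq0 _ _ S fst (- (A * (c^*)%C))
    (c * (c^*)%C + A * (A^*)%C - B * (B^*)%C) (- (c * (A^*)%C)) infS.
- move=> z Sz.
  have [[/[dup] /unit_conj e1 /unit_neq0 n1 + _] _] := Sc z Sz.
  move=> /[dup] /unit_conj e2 /unit_neq0 n2.
  have := h z Sz => /[dup] /(congr1 (@conjc R)).
  rewrite rmorphD !rmorphM /= e1 e2 => hc {}h.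
  have : (B * z.2) * ((B^*)%C / z.2) = (c - A * z.1) * ((c^*)%C - (A^*)%C / z.1).
    by rewrite -hc -h; ring.
  rewrite (_ : _ * _ = B * (B^*)%C); last by field.
  by move=> ->; field.
- apply: (@sub_finite_set _ _ [set (y, (c - A * y) / B)]); last exact: finite_set1.
  by move=> [a b] [/zB/= -> /= ->].
have c0 : c = 0.
  by move: h1; rewrite oppr_eq0 mulf_eq0 (negPf A0) conjc_eq0 => /eqP.
have zu z : S z -> z.2 = (- A / B) * z.1 by move/zB ->; rewrite c0; ring.
have u0 : - A / B != 0 by rewrite mulf_neq0 ?oppr_eq0 ?invr_eq0.
have [? ? u1] := infinite_ratio_const _ _ tS u0 zu; constructor 2; split=> //.
  by rewrite -[X in _ + X]mul1r -u1 divfK// subrr.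
by move=> z /zu ->; rewrite u1 mul1r.
Qed.

End Static.

(** * Angular momentum in real coordinates *)

Lemma unit_coord (R : realType) (a b : R) : `|a +i* b| = 1 <-> a ^+ 2 + b ^+ 2 = 1.
Proof.
have := add_Re2_Im2 (a +i* b); rewrite /= => h; split=> [n1|ab].
  by apply: complexI; rewrite h n1 expr1n.
have /eqP := h; rewrite ab eq_sym sqrf_eq1 => /orP[/eqP//|/eqP e].
by have := normr_ge0 (a +i* b); rewrite e ler0N1.
Qed.

Lemma complex_ext (R : realType) (z w : R[i]) :
  complex.Re z = complex.Re w -> complex.Im z = complex.Im w -> z = w.
Proof. by case: z w => [? ?] [? ?] /= -> ->. Qed.

Lemma unit_inv (R : realType) (a b : R) :
  a ^+ 2 + b ^+ 2 = 1 -> (a +i* b)^-1 = a -i* b.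
Proof. by move/unit_coord/unit_conj => <-. Qed.

Section Coordinates.
Context (R : realType) (L : linkage R) (M : masses R) (a b u v : R).
Context (ab1 : a ^+ 2 + b ^+ 2 = 1) (uv1 : u ^+ 2 + v ^+ 2 = 1).
Local Notation g1 := (- (len1 L / len3 L)).
Local Notation g2 := (len2 L / len3 L).
Local Notation g3 := (base L / len3 L).
Local Notation m3 := (mass (link3 M)).
Local Notation r3 := (offset (link3 M)).
Local Notation pc := (complex.Re (dir (link3 M))).
Local Notation ps := (complex.Im (dir (link3 M))).
Local Notation x2 := (mass (link2 M) * offset (link2 M) * complex.Re (dir (link2 M))).
Local Notation y2 := (mass (link2 M) * offset (link2 M) * complex.Im (dir (link2 M))).
Local Notation z1 := (a +i* b).
Local Notation z2 := (u +i* v).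
Local Notation C := (u * a + v * b).
Local Notation S := (v * a - u * b).

Lemma Gfun_coord : Gfun L z1 z2 =
  (g1 ^+ 2 + g2 ^+ 2 + g3 ^+ 2 - 1 + 2 * g1 * g2 * C + 2 * g1 * g3 * a
   + 2 * g2 * g3 * u)%:C.
Proof.
rewrite /Gfun !unit_inv// /G1 /G2 /G3.
(* Writing a^2 + b^2 and u^2 + v^2 for 1 at the right places yields an identity valid for all real
   a, b, u, v, which [ring] can prove. The device recurs below. *)
have -> : g1 ^+ 2 = g1 ^+ 2 * (a ^+ 2 + b ^+ 2) by rewrite ab1 mulr1.
have -> : g2 ^+ 2 = g2 ^+ 2 * (u ^+ 2 + v ^+ 2) by rewrite uv1 mulr1.
move: (len1 L / _) g2 g3 => h1 h2 h3.
by apply: complex_ext => /=; ring.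
Qed.

Lemma K1_coord : K1 L z1 z2 = 'i%C * (2 * (g1 * (g3 * b - g2 * S)))%:C.
Proof.
rewrite /K1 !unit_inv// /G1 /G2 /G3; move: (len1 L / _) g2 g3 => h1 h2 h3.
by apply: complex_ext => /=; ring.
Qed.

Lemma K2_coord : K2 L z1 z2 = 'i%C * (2 * (g2 * (g1 * S + g3 * v)))%:C.
Proof.
rewrite /K2 !unit_inv// /G1 /G2 /G3; move: (len1 L / _) g2 g3 => h1 h2 h3.
by apply: complex_ext => /=; ring.
Qed.

Lemma K_coord : K L M z1 z2 = 0 <->
  g1 * (g3 * b - g2 * S) * K4 L M z1 z2
  - g2 * (g1 * S + g3 * v) * K3 L M z1 z2 = 0.
Proof.
rewrite /K K1_coord K2_coord; move: (_ * (g3 * b - _)) (_ * (_ + g3 * v)) => k1 k2.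
move: (K3 _ _ _ _) (K4 _ _ _ _) => k3 k4.
have -> : 'i%C * (2 * k1)%:C * k4%:C - 'i%C * (2 * k2)%:C * k3%:C =
  'i%C * (2 * (k1 * k4 - k2 * k3))%:C by apply: complex_ext => /=; ring.
split=> [|->]; last by rewrite mulr0 mulr0.
move/eqP; rewrite mulf_eq0 fmorph_eq0 mulf_eq0 pnatr_eq0 /= => /orP[|/eqP//].
by rewrite eq_complex /= oner_eq0 andbF.
Qed.

Context (p3u : pc ^+ 2 + ps ^+ 2 = 1).

Lemma K3_coord : K3 L M z1 z2 = Jmom (link1 M) + m3 * len1 L ^+ 2
  + 2 * len1 L * g1 * (m3 * r3 * pc)
  + len1 L * (g2 * (m3 * r3 * pc * C - m3 * r3 * ps * S)
              + g3 * (m3 * r3 * pc * a + m3 * r3 * ps * b))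
  + Jmom (link3 M) * (g1 * (g1 + g2 * C + g3 * a)).
Proof.
transitivity (Jmom (link1 M) + m3 * (len1 L ^+ 2 * (a ^+ 2 + b ^+ 2))
  + 2 * len1 L * (g1 * (a ^+ 2 + b ^+ 2)) * (m3 * r3 * pc)
  + len1 L * (g2 * (m3 * r3 * pc * C - m3 * r3 * ps * S)
              + g3 * (m3 * r3 * pc * a + m3 * r3 * ps * b))
  + (inertia (link3 M) + m3 * r3 ^+ 2 * (pc ^+ 2 + ps ^+ 2))
    * (g1 * (g1 * (a ^+ 2 + b ^+ 2) + g2 * C + g3 * a))); last first.
  by rewrite ab1 p3u !mulr1.
rewrite /K3 /angmom /coupler /dotc /G1 /G2 /G3.
move: (len1 L / _) g2 g3 => h1 h2 h3.
case: (dir (link3 M)) => p q; case: (dir (link2 M)) => p' q' /=.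
by ring.
Qed.

Lemma K4_coord : K4 L M z1 z2 = Jmom (link2 M)
  + base L * (x2 * u - y2 * v)
  + len1 L * g2 * (m3 * r3 * pc * C - m3 * r3 * ps * S)
  + Jmom (link3 M) * (g2 * (g2 + g1 * C + g3 * u)).
Proof.
transitivity (Jmom (link2 M)
  + base L * (x2 * u - y2 * v)
  + len1 L * g2 * (m3 * r3 * pc * C - m3 * r3 * ps * S)
  + (inertia (link3 M) + m3 * r3 ^+ 2 * (pc ^+ 2 + ps ^+ 2))
    * (g2 * (g2 * (u ^+ 2 + v ^+ 2) + g1 * C + g3 * u))); last first.
  by rewrite uv1 p3u !mulr1.
rewrite /K4 /angmom /coupler /dotc /G1 /G2 /G3.
move: (len1 L / _) g2 g3 => h1 h2 h3.
case: (dir (link3 M)) => p q; case: (dir (link2 M)) => p' q' /=.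
by ring.
Qed.
End Coordinates.

(* [c] + i [k2] is G_2 z_2 conj(z_3), [c3] + i [k1] is G_1 z_1 conj(z_3), [e] is
   Im (G_1 G_3 z_1), and [bt] is the squared length of the diagonal
   G_1 z_1 + G_3; the velocities satisfy w_1 : w_2 = k2 : - k1 and
   w_3 = c3 w_1 + c w_2. *)
Section Trigonometry.
Context (R : realType) (g1 g2 g3 a b u v : R).
Context (ab1 : a ^+ 2 + b ^+ 2 = 1) (uv1 : u ^+ 2 + v ^+ 2 = 1).
Local Notation C := (u * a + v * b).
Local Notation S := (v * a - u * b).
Context (closure : g1 ^+ 2 + g2 ^+ 2 + g3 ^+ 2 - 1 + 2 * g1 * g2 * C
  + 2 * g1 * g3 * a + 2 * g2 * g3 * u = 0).
Local Notation k1 := (g1 * (g3 * b - g2 * S)).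
Local Notation k2 := (g2 * (g1 * S + g3 * v)).
Local Notation c := (g2 * (g2 + g1 * C + g3 * u)).
Local Notation c3 := (g1 * (g1 + g2 * C + g3 * a)).
Local Notation e := (g1 * g3 * b).
Local Notation bt := (g1 ^+ 2 + g3 ^+ 2 + 2 * g1 * g3 * a).
Local Notation nu := (g1 ^+ 2 + g1 * g3 * a).

(** Law of cosines in the triangle z_3 - G_2 z_2 = D, with D = G_1 z_1 + G_3. *)
Lemma diagE : bt = 1 + g2 ^+ 2 - 2 * c.
Proof. by apply/eqP; rewrite -subr_eq0 -closure; apply/eqP; ring. Qed.

(** The number G_2 z_2 conj(z_3) has squared modulus g2^2, since [closure] says |z_3| = 1. *)
Lemma sqr_k2 : k2 ^+ 2 = g2 ^+ 2 - c ^+ 2.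
Proof.
have z3 : (g1 * a + g2 * u + g3) ^+ 2 + (g1 * b + g2 * v) ^+ 2 = 1.
  apply/eqP; rewrite -subr_eq0 -closure; apply/eqP.
  transitivity (g1 ^+ 2 * (a ^+ 2 + b ^+ 2) + g2 ^+ 2 * (u ^+ 2 + v ^+ 2)
    + g3 ^+ 2 - 1 + 2 * g1 * g2 * C + 2 * g1 * g3 * a + 2 * g2 * g3 * u).
    by ring.
  by rewrite ab1 uv1; ring.
have -> : c = g2 * (g2 * (u ^+ 2 + v ^+ 2) + g1 * C + g3 * u).
  by rewrite uv1 mulr1.
transitivity (g2 ^+ 2 * (u ^+ 2 + v ^+ 2)
    * ((g1 * a + g2 * u + g3) ^+ 2 + (g1 * b + g2 * v) ^+ 2)
  - (g2 * (g2 * (u ^+ 2 + v ^+ 2) + g1 * C + g3 * u)) ^+ 2); first by ring.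
by rewrite z3 uv1 !mulr1.
Qed.

Lemma sqr_e : e ^+ 2 = g1 ^+ 2 * g3 ^+ 2
  - ((1 + g2 ^+ 2 - g1 ^+ 2 - g3 ^+ 2) / 2 - c) ^+ 2.
Proof.
have -> : (1 + g2 ^+ 2 - g1 ^+ 2 - g3 ^+ 2) / 2 - c = g1 * g3 * a.
  by have := diagE; lra.
by have -> : e ^+ 2 = g1 ^+ 2 * g3 ^+ 2 * (a ^+ 2 + b ^+ 2 - a ^+ 2);
  [ring | rewrite ab1; ring].
Qed.

(** This and [diag_c3] are the imaginary and real parts of |D|^2 G_1 z_1 conj(z_3) = (G_1 z_1
    conj(D)) (D conj(z_3)), whose factors are nu + i e and 1 - c - i k2. *)
Lemma diag_k1 : bt * k1 = e * (1 - c) - nu * k2.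
Proof.
have -> : 1 - c = bt + g2 * (g1 * C + g3 * u) by have := diagE; lra.
have -> : g1 ^+ 2 = g1 ^+ 2 * (a ^+ 2 + b ^+ 2) by rewrite ab1 mulr1.
by ring.
Qed.

Lemma diag_c3 : bt * c3 = nu * (1 - c) + e * k2.
Proof.
have -> : 1 - c = bt + g2 * (g1 * C + g3 * u) by have := diagE; lra.
have -> : c3 = g1 ^+ 2 + g1 * g2 * C + g1 * g3 * a by ring.
have -> : g1 ^+ 2 = g1 ^+ 2 * (a ^+ 2 + b ^+ 2) by rewrite ab1 mulr1.
by ring.
Qed.

(** The factor bt lets [diag_k1] and [diag_c3] eliminate k1 and c3. The two Y terms add up to 2 Y k1
    k2, and nu = n - c. *)
Lemma angmom_biquadratic (B1 B2 B3 Y : R) :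
  let n := (1 + g1 ^+ 2 + g2 ^+ 2 - g3 ^+ 2) / 2 in
  bt * (k1 * (B2 + B3 * c + Y * k2) - k2 * (B1 + B3 * c3 - Y * k1)) =
    - (2 * Y * (n - c) * (g2 ^+ 2 - c ^+ 2))
    + ((B3 - B2) * c + (B2 - B3 * g2 ^+ 2)) * e
    - ((n - c) * (B2 + B3) + (1 + g2 ^+ 2 - 2 * c) * B1) * k2
    + 2 * Y * (1 - c) * e * k2.
Proof.
move=> n; have -> : n - c = nu by rewrite /n; have := diagE; lra.
rewrite -sqr_k2 -diagE.
have -> : g2 ^+ 2 = c ^+ 2 + k2 ^+ 2 by rewrite sqr_k2; ring.
rewrite [LHS](_ : _ = (bt * k1) * (B2 + B3 * c + 2 * Y * k2)
  - k2 * (bt * B1 + B3 * (bt * c3))); last by ring.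
rewrite diag_k1 diag_c3; move: c e k2 bt => c' e' k2' bt'.
by ring.
Qed.
End Trigonometry.

Definition moment_re {R : realType} (p : link_mass R) : R :=
  mass p * offset p * complex.Re (dir p).
Definition moment_im {R : realType} (p : link_mass R) : R :=
  mass p * offset p * complex.Im (dir p).

(* For F_1 = F_2 = 0 the angular momentum is
   [bal1] w_1 + [bal2] w_2 + [bal3] w_3 + [balY] (k_2 w_2 - k_1 w_1), where
   k_j = K_j / 2i. *)
Section Balance.
Context {R : realType} (L : linkage R) (M : masses R).
Definition bal1 : R := Jmom (link1 M) + mass (link3 M) * len1 L ^+ 2
  - (len1 L / len3 L) ^+ 2 * (len3 L * moment_re (link3 M)).
Definition bal2 : R :=
  Jmom (link2 M) + (len2 L / len3 L) ^+ 2 * (len3 L * moment_re (link3 M)).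
Definition bal3 : R := Jmom (link3 M) - len3 L * moment_re (link3 M).
Definition balY : R := len3 L * moment_im (link3 M).

Lemma F1_coord : F1 L M = (moment_re (link1 M) + mass (link3 M) * len1 L
    - len1 L / len3 L * moment_re (link3 M))
  +i* (moment_im (link1 M) - len1 L / len3 L * moment_im (link3 M)).
Proof.
rewrite /F1 /G1 /moment_re /moment_im; move: (len1 L / _) => h1.
case: (dir (link1 M)) => p q; case: (dir (link3 M)) => p' q'.
by apply: complex_ext => /=; ring.
Qed.

Lemma F2_coord : F2 L M =
  (moment_re (link2 M) + len2 L / len3 L * moment_re (link3 M))
  +i* (moment_im (link2 M) + len2 L / len3 L * moment_im (link3 M)).
Proof.
rewrite /F2 /G2 /moment_re /moment_im; move: (len2 L / _) => h2.
case: (dir (link2 M)) => p q; case: (dir (link3 M)) => p' q'.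
by apply: complex_ext => /=; ring.
Qed.

Lemma Jmom_gt0 (p : link_mass R) : admissible_link p -> 0 < Jmom p.
Proof. by case=> m0 i0 r0 _; rewrite /Jmom ltr_wpDr// mulr_ge0 ?exprn_ge0// ltW. Qed.

Context (len3_gt0 : 0 < len3 L) (Madm : admissible M).
Context (F20 : F2 L M = 0).
Context (a b u v : R) (ab1 : a ^+ 2 + b ^+ 2 = 1) (uv1 : u ^+ 2 + v ^+ 2 = 1).
Local Notation g1 := (- (len1 L / len3 L)).
Local Notation g2 := (len2 L / len3 L).
Local Notation g3 := (base L / len3 L).
Local Notation C := (u * a + v * b).
Local Notation S := (v * a - u * b).
Local Notation k1 := (g1 * (g3 * b - g2 * S)).
Local Notation k2 := (g2 * (g1 * S + g3 * v)).

Let dir3 : complex.Re (dir (link3 M)) ^+ 2 + complex.Im (dir (link3 M)) ^+ 2 = 1.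
Proof. by case: Madm => _ _ [_ _ _]; case: (dir _) => p q /unit_coord. Qed.

Let len1E : len1 L = len1 L / len3 L * len3 L.
Proof. by rewrite divfK// gt_eqF. Qed.

Let baseE : base L = g3 * len3 L.
Proof. by rewrite divfK// gt_eqF. Qed.

Lemma K3_balanced : K3 L M (a +i* b) (u +i* v) =
  bal1 + bal3 * (g1 * (g1 + g2 * C + g3 * a)) - balY * k1.
Proof.
rewrite K3_coord// /bal1 /bal3 /balY /moment_re /moment_im.
move: len1E; move: (len1 L / _) g2 g3 => h1 h2 h3 ->.
by ring.
Qed.

(** F_2 = 0 replaces the static moment of link 2 by - G_2 times that of the coupler, the only static
    moment that remains. *)
Lemma K4_balanced : K4 L M (a +i* b) (u +i* v) =
  bal2 + bal3 * (g2 * (g2 + g1 * C + g3 * u)) + balY * k2.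
Proof.
rewrite K4_coord// -/(moment_re _) -/(moment_im _).
move: F20; rewrite F2_coord => -[/eqP + /eqP].
rewrite !addr_eq0 => /eqP -> /eqP ->.
rewrite /bal2 /bal3 /balY -/(moment_re _) -/(moment_im _).
move: len1E baseE; move: (len1 L / _) g2 g3 => h1 h2 h3 -> ->.
by move: (moment_re _) (moment_im _) => x y; ring.
Qed.

Lemma K_balanced : K L M (a +i* b) (u +i* v) = 0 <->
  k1 * (bal2 + bal3 * (g2 * (g2 + g1 * C + g3 * u)) + balY * k2)
  - k2 * (bal1 + bal3 * (g1 * (g1 + g2 * C + g3 * a)) - balY * k1) = 0.
Proof. by rewrite K_coord// K3_balanced K4_balanced. Qed.
End Balance.

Section Infinite.
Context (R : realType) (d l1 l2 l3 : R).
Context (hd : 0 < d) (hl1 : 0 < l1) (hl2 : 0 < l2) (hl3 : 0 < l3).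
Local Notation L := (Linkage d l1 l2 l3).

(** If p were nonzero, Re z_1 would be constant on an infinite subset. A unit number with given real
    part is a root of a quadratic, so z_1 itself would be constant on an infinite subset, which
    [infinite_fst_const] allows only for z_1 = 1. This supplies the [dense] hypothesis of the
    separation lemmas. *)
Lemma poly_Re_eq0 S (p : {poly R}) (al be : R) : trajectory L setT S ->
  (l1 = d /\ l2 = l3 -> forall z, S z -> z.1 <> 1) -> be != 0 ->
  (forall z, S z -> p.[al + be * complex.Re z.1] = 0) -> p = 0.
Proof.
move=> [infS Sc] n2 be0 pS; apply: contrapT => /eqP p0.
have [r infr] := infinite_fiber _ _ S (fun z => al + be * complex.Re z.1) p infS p0 pS.
set S' := _ `&` _ in infr.
have SS' : S' `<=` S by move=> z [].
set x := (r - al) / be.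
have ReS z : S' z -> complex.Re z.1 = x.
  by rewrite /x => -[_ /= <-]; rewrite addrAC subrr add0r mulrC mulKf.
suff fin y : finite_set (S' `&` fst @^-1` [set y]).
  have [|//|] := @quadratic_eq0 _ _ S' fst 1 (- (2 * x)%:C) 1 infr; last first.
    by move/eqP; rewrite oner_eq0.
  move=> z S'z; have [[+ _ _] _] := Sc z (SS' z S'z).
  have := ReS z S'z; case: z.1 => a b /= -> /unit_coord ab1.
  rewrite mul1r expr2; have -> : (1 : R[i]) = (x ^+ 2 + b ^+ 2)%:C by rewrite ab1.
  by apply: complex_ext => /=; ring.
apply: contrapT => inf.
have tS'' : trajectory L setT (S' `&` fst @^-1` [set y]).
  by split=> // z [/SS'/Sc].
have [|? ? y1] := @infinite_fst_const _ _ _ _ _ hd hl1 hl2 hl3 _ y tS''.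
  by move=> z [].
have [z [/SS' Sz /= zy]] := infinite_setN0 inf.
by apply: (n2 _ z Sz); rewrite ?zy.
Qed.
End Infinite.
Arguments bal1 : simpl never.
Arguments bal2 : simpl never.
Arguments bal3 : simpl never.
Arguments balY : simpl never.

(** * Separation of the square roots *)

(** The two radicands have roots t + h, t - h and g, - g. Each has simple roots because g and h are
    nonzero, and so has the product unless the two pairs coincide, that is, t = 0 and g^2 = h^2. *)
Lemma biquadratic_separation (F : realFieldType) (Q : F -> Prop) (g h t : F)
    (p0 p1 p2 p3 : {poly F}) :
  (forall p : {poly F}, (forall c, Q c -> p.[c] = 0) -> p = 0) ->
  g != 0 -> h != 0 -> ~ (t = 0 /\ g ^+ 2 = h ^+ 2) ->
  (forall c, Q c -> exists e k, [/\ e ^+ 2 = h ^+ 2 - (t - c) ^+ 2,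
     k ^+ 2 = g ^+ 2 - c ^+ 2 &
     p0.[c] + p1.[c] * e + p2.[c] * k + p3.[c] * e * k = 0]) ->
  [/\ p0 = 0, p1 = 0, p2 = 0 & p3 = 0].
Proof.
move=> dense g0 h0 th rel.
(* [E' x] and [K' x] are the cofactors of X - x for either root x, so that the sign of the root can
   be chosen later. *)
pose E' x := - ('X - (2 * t - x)%:P : {poly F}).
pose K' x := - ('X - (- x)%:P : {poly F}).
pose E : {poly F} := ('X - (t + h)%:P) * E' (t + h).
pose K : {poly F} := ('X - g%:P) * K' g.
have Ex x : (x - t) ^+ 2 = h ^+ 2 -> E = ('X - x%:P) * E' x.
  move/eqP; rewrite eqf_sqr => /orP[]/eqP xt; rewrite /E /E'.
    by rewrite (_ : t + h = x)// -xt; ring.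
  have -> : x = t - h by rewrite -xt; ring.
  by rewrite (_ : t + h = 2 * t - (t - h)); [|ring];
     rewrite (_ : 2 * t - (2 * t - (t - h)) = t - h); [|ring]; rewrite !mulrN mulrC.
have Kx x : x ^+ 2 = g ^+ 2 -> K = ('X - x%:P) * K' x.
  move/eqP; rewrite eqf_sqr /K /K' => /orP[]/eqP -> //.
  by rewrite opprK !mulrN mulrC.
have EE c : E.[c] = h ^+ 2 - (t - c) ^+ 2 by rewrite /E /E' !hornerE; ring.
have KE c : K.[c] = g ^+ 2 - c ^+ 2 by rewrite /K /K' !hornerE; ring.
have EF := Ex (t + h); have KF := Kx g; clearbody E K.
have rE' x : root (E' x) x = (x == t).
  rewrite /E' rootN root_XsubC -subr_eq0 (_ : _ - _ = 2 * (x - t)); last by ring.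
  by rewrite mulf_eq0 pnatr_eq0 subr_eq0.
have rK' x : root (K' x) x = (x == 0).
  by rewrite /K' rootN root_XsubC -addr_eq0 -mulr2n mulrn_eq0.
have [z [M [EK nM]]] : exists z M, E * K = ('X - z%:P) * M /\ ~~ root M z.
  have side x : x ^+ 2 = g ^+ 2 -> ~~ root E x ->
      exists z M, E * K = ('X - z%:P) * M /\ ~~ root M z.
    move=> xg nE; exists x, (E * K' x); rewrite {1}(Kx x xg) mulrCA; split=> //.
    rewrite rootM negb_or nE rK'; apply: contra_neq g0 => x0.
    by apply/eqP; rewrite -sqrf_eq0 -xg x0 expr0n.
  (* One of g, - g is a simple root of E K unless both are roots of E, which is the excluded
     case. *)
  have [rg|] := boolP (root E g); last exact: side.
  have [rg'|] := boolP (root E (- g)); last by apply: side; rewrite sqrrN.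
  case: th; move/rootP: rg; move/rootP: rg'; rewrite !EE => e1 e2.
  have t0 : t = 0.
    have : 4 * g * t = 0 by rewrite -(subrr 0) -{1}e2 -e1; ring.
    by move/eqP; rewrite !mulf_eq0 (negPf g0) pnatr_eq0 => /eqP.
  by split=> //; move: e2; rewrite t0; lra.
apply: (@biquadratic_norm_eq0 _ _ _ _ _ E (E' (t + h)) K (K' g) M (t + h) g z) => //.
- by apply: EF; ring.
- by rewrite rE' -subr_eq0 addrAC subrr add0r.
- exact: KF.
- by rewrite rK'.
- by rewrite pnatr_eq0.
(* Squaring p0 + p1 e = - (p2 + p3 e) k leaves a relation linear in e; squaring again gives the norm
   equation, polynomial in c. *)
apply/eqP; rewrite -subr_eq0; apply/eqP; apply: dense => c Qc.
have [e [k [he hk r]]] := rel c Qc.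
rewrite !(hornerE, horner_exp) EE KE -he -hk.
move: p0.[c] p1.[c] p2.[c] p3.[c] r => q0 q1 q2 q3 r.
have {}r : q0 = - (q1 * e + q2 * k + q3 * e * k).
  by apply/eqP; rewrite -addr_eq0 -r; apply/eqP; ring.
by rewrite r; ring.
Qed.

Lemma config_coord (R : realType) (L : linkage R) (a b u v : R) :
  let g1 := - (len1 L / len3 L) in
  let g2 := len2 L / len3 L in
  let g3 := base L / len3 L in
  configuration L (a +i* b, u +i* v) <->
  [/\ a ^+ 2 + b ^+ 2 = 1, u ^+ 2 + v ^+ 2 = 1 &
    g1 ^+ 2 + g2 ^+ 2 + g3 ^+ 2 - 1 + 2 * g1 * g2 * (u * a + v * b)
    + 2 * g1 * g3 * a + 2 * g2 * g3 * u = 0].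
Proof.
split=> -[/= /unit_coord ab1 /unit_coord uv1].
  by rewrite Gfun_coord// => /(congr1 (@complex.Re R)); split.
move=> cl; split=> //=; rewrite Gfun_coord; [|exact/unit_coord..].
by congr _%:C; exact: cl.
Qed.

(** * The angular momentum as a relation between c, e and k_2 *)

Section Generic.
Context (R : realType) (d l1 l2 l3 : R).
Context (hd : 0 < d) (hl1 : 0 < l1) (hl2 : 0 < l2) (hl3 : 0 < l3).
Local Notation L := (Linkage d l1 l2 l3).
Local Notation g1 := (- (l1 / l3)).
Local Notation g2 := (l2 / l3).
Local Notation g3 := (d / l3).
Context (M : masses R) (Madm : admissible M).
Context (F20 : F2 L M = 0).
Local Notation B1 := (bal1 L M).
Local Notation B2 := (bal2 L M).
Local Notation B3 := (bal3 L M).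
Local Notation Y := (balY L M).
Local Notation n := ((1 + g1 ^+ 2 + g2 ^+ 2 - g3 ^+ 2) / 2).

Lemma ratio_eq (x y : R) : x / l3 = y / l3 -> x = y.
Proof. by apply/mulIf; rewrite invr_eq0 gt_eqF. Qed.

Lemma ratio_eq1 (x : R) : x / l3 = 1 -> x = l3.
Proof. by move=> h; apply: ratio_eq; rewrite h divff// gt_eqF. Qed.

(** The static moment of the coupler enters [bal2] and [bal3] with opposite signs, so it cannot make
    both nonpositive. *)
Lemma bal2_or_bal3_gt0 : 0 < B2 \/ 0 < B3.
Proof.
case: Madm => _ /Jmom_gt0 J2 /Jmom_gt0 J3.
rewrite /bal2 /bal3 /=; set x := l3 * _.
have [x0|x0] := leP 0 x; [left|right; lra].
by rewrite ltr_wpDr// mulr_ge0// exprn_ge0// ltW// divr_gt0.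
Qed.

(** P is |D|^2 (k_1 K_4 - k_2 K_3), whence the condition D <> 0 in the converse. Here c is written
    through a = Re z_1, the form that [poly_Re_eq0] handles. *)
Lemma angmom_coord (a b u v : R) : configuration L (a +i* b, u +i* v) ->
  let c := (1 + g2 ^+ 2 - g1 ^+ 2 - g3 ^+ 2) / 2 + - (g1 * g3) * a in
  let e := g1 * g3 * b in
  let k2 := g2 * (g1 * (v * a - u * b) + g3 * v) in
  [/\ e ^+ 2 = (g1 * g3) ^+ 2
         - ((1 + g2 ^+ 2 - g1 ^+ 2 - g3 ^+ 2) / 2 - c) ^+ 2,
      k2 ^+ 2 = g2 ^+ 2 - c ^+ 2 &
      let P := - (2 * Y * (n - c) * (g2 ^+ 2 - c ^+ 2))
      + ((B3 - B2) * c + (B2 - B3 * g2 ^+ 2)) * e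
      - ((n - c) * (B2 + B3) + (1 + g2 ^+ 2 - 2 * c) * B1) * k2
      + 2 * Y * (1 - c) * e * k2 in
      (K L M (a +i* b) (u +i* v) = 0 -> P = 0) /\
      (1 + g2 ^+ 2 - 2 * c != 0 -> P = 0 -> K L M (a +i* b) (u +i* v) = 0)].
Proof.
move/config_coord => [ab1 uv1 cl] c e k2; rewrite /= in cl.
have cE : c = g2 * (g2 + g1 * (u * a + v * b) + g3 * u).
  by rewrite /c; have := diagE _ _ _ _ _ _ _ _ cl; lra.
have btE : 1 + g2 ^+ 2 - 2 * c = g1 ^+ 2 + g3 ^+ 2 + 2 * g1 * g3 * a.
  by rewrite /c; field; rewrite gt_eqF.
have P := angmom_biquadratic _ _ _ _ _ _ _ _ ab1 uv1 cl B1 B2 B3 Y.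
have KP := K_balanced L M hl3 Madm F20 a b u v ab1 uv1.
split.
- by have := sqr_e _ _ _ _ _ _ _ _ ab1 cl; rewrite -exprMn -cE.
- by rewrite cE; exact: sqr_k2.
rewrite /= in P KP; move: btE; rewrite cE => btE; split.
  by move/KP => KP0; rewrite -[LHS]P KP0 mulr0.
move=> + P0; rewrite btE => bt0; apply/KP; apply: (mulfI bt0); rewrite mulr0 P.
exact: P0.
Qed.

End Generic.

Section AngmomCoefs.
Context (R : realType) (d l1 l2 l3 : R).
Context (hd : 0 < d) (hl1 : 0 < l1) (hl2 : 0 < l2) (hl3 : 0 < l3).
Local Notation L := (Linkage d l1 l2 l3).
Local Notation g1 := (- (l1 / l3)).
Local Notation g2 := (l2 / l3).
Local Notation g3 := (d / l3).
Context (M : masses R) (Madm : admissible M).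
Context (F20 : F2 L M = 0).
Local Notation B1 := (bal1 L M).
Local Notation B2 := (bal2 L M).
Local Notation B3 := (bal3 L M).
Local Notation Y := (balY L M).
Local Notation n := ((1 + g1 ^+ 2 + g2 ^+ 2 - g3 ^+ 2) / 2).
Context (S : set (R[i] * R[i])) (tS : trajectory L setT S).
Context (K0 : forall z, S z -> K L M z.1 z.2 = 0).

(** Serves both the linkages outside the three families and the deltoid l_1 = d, l_2 = l_3 off z_1 =
    1, where the square roots are still independent. *)
Lemma angmom_coefs :
  (l1 = d /\ l2 = l3 -> forall z, S z -> z.1 <> 1) ->
  ~ (l1 = l2 /\ l3 = d) -> ~ (l2 = d /\ l1 = l3) ->
  [/\ Y = 0, B1 = - B3, B2 = B3, B3 * (1 - g2 ^+ 2) = 0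
    & B3 * (g1 ^+ 2 - g3 ^+ 2) = 0].
Proof.
move=> n2 n1 n3; pose hE := (hornerXn, hornerD, hornerN, hornerM, hornerZ, hornerC, hornerX).
have g1n : g1 != 0 by rewrite oppr_eq0 gt_eqF ?divr_gt0.
have g2n : g2 != 0 by rewrite gt_eqF ?divr_gt0.
have g3n : g3 != 0 by rewrite gt_eqF ?divr_gt0.
pose t := (1 + g2 ^+ 2 - g1 ^+ 2 - g3 ^+ 2) / 2.
pose Q c := exists2 z, S z & c = t + - (g1 * g3) * complex.Re z.1.
pose p0 : {poly R} := - (2 * Y) *: ((n%:P - 'X) * ((g2 ^+ 2)%:P - 'X ^+ 2)).
pose p1 : {poly R} := (B3 - B2) *: 'X + (B2 - B3 * g2 ^+ 2)%:P.
pose p2 : {poly R} := - ((n%:P - 'X) * (B2 + B3)%:P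
  + ((1 + g2 ^+ 2)%:P - 2 *: 'X) * B1%:P).
pose p3 : {poly R} := (2 * Y) *: (1 - 'X).
have [|||||_ p10 p20 p30] :=
    @biquadratic_separation _ Q g2 (g1 * g3) t p0 p1 p2 p3.
- move=> p pQ; apply: (@poly_Re_eq0 _ _ _ _ _ hd hl1 hl2 hl3 S p t (- (g1 * g3))) => //.
    by rewrite oppr_eq0 mulf_neq0.
  by move=> z Sz; apply: pQ; exists z.
- exact: g2n.
- by rewrite mulf_neq0.
(* If the two pairs of roots coincide, then (1 - g1^2) (1 - g3^2) = 0, so l_1 = l_3 or d = l_3, and
   g2 = |g1 g3| supplies the second equality of an excluded pair. *)
- case=> t0 g2E.
  have : (1 - g1 ^+ 2) * (1 - g3 ^+ 2) = 0.
    have -> : (1 - g1 ^+ 2) * (1 - g3 ^+ 2) = 2 * t + ((g1 * g3) ^+ 2 - g2 ^+ 2).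
      by rewrite /t; move: g1 g2 g3 => x y w; field.
    by rewrite t0 g2E; ring.
  have sq1 x : 0 < x -> 1 - (x / l3) ^+ 2 = 0 -> x = l3.
    move=> x0 /subr0_eq /esym/eqP; rewrite sqrf_eq1 => /orP[/eqP|/eqP h].
      exact: ratio_eq1.
    by have := divr_gt0 x0 hl3; rewrite h ltr0N1.
  move: g2E => /eqP; rewrite eqf_sqr => g2E.
  move/eqP; rewrite mulf_eq0 sqrrN => /orP[/eqP/(sq1 _ hl1) e|/eqP/(sq1 _ hd) e].
    apply: n3; split=> //; apply: (ratio_eq _ _ hl3) => //.
    have e1 : l1 / l3 = 1 by rewrite e divff ?gt_eqF.
    move: g2E; rewrite e1 mulN1r opprK => /orP[]/eqP // h.
    by have := divr_gt0 hd hl3; have := divr_gt0 hl2 hl3; rewrite h; lra.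
  apply: n1; split=> //; apply/esym/(ratio_eq _ _ hl3).
  have e1 : d / l3 = 1 by rewrite e divff ?gt_eqF.
  move: g2E; rewrite e1 mulr1 opprK orbC => /orP[]/eqP // h.
  by have := divr_gt0 hl1 hl3; have := divr_gt0 hl2 hl3; rewrite h; lra.
- move=> c [[[a b] [u v]] Sz /= cE].
  have [cz _] := tS.2 _ Sz.
  have [e2 k2 [P _]] := @angmom_coord _ _ _ _ _ hl3 M Madm F20 a b u v cz.
  move: e2 k2 P; rewrite -/t -cE => e2 k2 P.
  have := P (K0 _ Sz); clear P.
  set e := g1 * g3 * b; set k := g2 * (_ + _) => P.
  exists e, k; split=> //.
  by rewrite -[RHS]P /p0 /p1 /p2 /p3 !hE; ring.
(* p1, p2 and p3 are affine in c, so evaluation at 0 and 1 extracts their coefficients. *)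
have ev (p : {poly R}) x : p = 0 -> p.[x] = 0 by move=> ->; rewrite horner0.
have Y0 : Y = 0.
  by have := ev _ 0 p30; rewrite /p3 !hE; lra.
have e1 : B2 = B3 * g2 ^+ 2.
  by have := ev _ 0 p10; rewrite /p1 !hE; lra.
have e2 : B2 = B3.
  by have := ev _ 1 p10; rewrite /p1 !hE; lra.
have e3 : n * (B2 + B3) + (1 + g2 ^+ 2) * B1 = 0.
  by have := ev _ 0 p20; rewrite /p2 !hE; lra.
have e4 : B1 = - B3.
  by have := ev _ 1 p20; rewrite /p2 !hE; move: e3 e2; lra.
split=> //.
  by rewrite mulrBr -e1 e2 mulr1 subrr.
move: e3; rewrite e2 e4 => e3; rewrite -[RHS]e3.
by move: g1 g2 g3 => x y w; field.
Qed.

End AngmomCoefs.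

(** * Factorisation of G for the parallelogram and the two deltoids *)

Section Factor.
Context (R : realType) (x y : R) (hx : 0 < x) (hy : 0 < y).
Local Notation g := ((x / y)%:C).

Let y_neq0 : y != 0. Proof. by rewrite gt_eqF. Qed.
Let g_neq0 : g != 0. Proof. by rewrite fmorph_eq0 gt_eqF ?divr_gt0. Qed.

(** The moving factor has degree one in z_2, as in [deltoid2_factor]; in [deltoid1_factor] it has
    degree one in z_1. Solving it gives the explicit trajectories below. *)
Lemma parallelogram_factor (z1 z2 : R[i]) : z1 != 0 -> z2 != 0 ->
  (Gfun (Linkage y x x y) z1 z2 = 0 <->
   z1 = z2 \/ z1 * z2 - 1 = g * (z2 - z1)).
Proof.
move=> n1 n2; rewrite /Gfun /G1 /G2 /G3 /= divff// rmorphN rmorph1 /=.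
have -> : (- g * z1 + g * z2 + 1) * (- g * z1^-1 + g * z2^-1 + 1) - 1 =
  g * (z2 - z1) / (z1 * z2) * (z1 * z2 - 1 - g * (z2 - z1)).
  by move: g => h; field; rewrite n1 n2.
split; last first.
  by case=> ->; rewrite subrr ?mulr0// mul0r mul0r.
move/eqP; rewrite !mulf_eq0 invr_eq0 mulf_eq0 (negPf g_neq0) (negPf n1) (negPf n2).
rewrite /= orbF !subr_eq0 => /orP[/eqP|/eqP]; first by left.
by right.
Qed.

Lemma deltoid1_factor (z1 z2 : R[i]) : z1 != 0 -> z2 != 0 ->
  (Gfun (Linkage x x y y) z1 z2 = 0 <->
   z1 = 1 \/ z1 * (1 + g * z2) = z2 * (z2 + g)).
Proof.
move=> n1 n2; rewrite /Gfun /G1 /G2 /G3 /= divff// rmorphN rmorph1 /=.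
have -> : (- g * z1 + 1 * z2 + g) * (- g * z1^-1 + 1 * z2^-1 + g) - 1 =
  g * (1 - z1) / (z1 * z2) * (z1 * (1 + g * z2) - z2 * (z2 + g)).
  by move: g => h; field; rewrite n1 n2.
split; last first.
  by case=> ->; rewrite subrr ?mulr0// mul0r mul0r.
move/eqP; rewrite !mulf_eq0 invr_eq0 mulf_eq0 (negPf g_neq0) (negPf n1) (negPf n2).
rewrite /= orbF !subr_eq0 => /orP[/eqP|/eqP]; first by left.
by right.
Qed.

Lemma deltoid2_factor (z1 z2 : R[i]) : z1 != 0 -> z2 != 0 ->
  (Gfun (Linkage x y x y) z1 z2 = 0 <->
   z2 = -1 \/ z2 * (g * z1 - 1) = z1 * (z1 - g)).
Proof.
move=> n1 n2; rewrite /Gfun /G1 /G2 /G3 /= divff// rmorphN rmorph1 /=.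
have -> : (-1 * z1 + g * z2 + g) * (-1 * z1^-1 + g * z2^-1 + g) - 1 =
  g * (z2 + 1) / (z1 * z2) * (z2 * (g * z1 - 1) - z1 * (z1 - g)).
  by move: g => h; field; rewrite n1 n2.
split; last first.
  by case=> ->; rewrite ?addNr ?subrr ?mulr0// mul0r mul0r.
move/eqP; rewrite !mulf_eq0 invr_eq0 mulf_eq0 (negPf g_neq0) (negPf n1) (negPf n2).
by rewrite /= orbF subr_eq0 addr_eq0 => /orP[/eqP|/eqP]; [left|right].
Qed.
End Factor.

(** For the components on which e and k_2 agree up to sign, so that one square root is left; g is a
    simple root of g^2 - c^2. *)
Lemma quadratic_separation (F : numFieldType) (Q : F -> Prop) (g : F)
    (p q : {poly F}) :
  (forall p : {poly F}, (forall c, Q c -> p.[c] = 0) -> p = 0) -> g != 0 ->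
  (forall c, Q c -> exists e, e ^+ 2 = g ^+ 2 - c ^+ 2 /\
     p.[c] + q.[c] * e = 0) ->
  p = 0 /\ q = 0.
Proof.
move=> dense g0 rel.
apply: (@mul_sqr_eq_sqr_eq0 _ p q (- ('X + g%:P)) g).
  by rewrite rootN /root !hornerE -mulr2n mulrn_eq0.
apply/eqP; rewrite -subr_eq0; apply/eqP; apply: dense => c Qc.
have [e [e2 h]] := rel c Qc.
have {}h : p.[c] = - (q.[c] * e) by apply/eqP; rewrite -addr_eq0 h.
rewrite !(hornerD, hornerN, hornerM, horner_exp, hornerX, hornerC) h.
transitivity (q.[c] ^+ 2 * (e ^+ 2 - (g ^+ 2 - c ^+ 2))); first by ring.
by rewrite e2 subrr mulr0.
Qed.

(** * Balance equations on the moving components with k_2 = e or k_2 = - e *)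

Section NontrivialModes.
Context (R : realType) (x y : R) (hx : 0 < x) (hy : 0 < y) (xy : x <> y).
Context (M : masses R) (Madm : admissible M).
Local Notation g := (x / y).

Let y_neq0 : y != 0. Proof. by rewrite gt_eqF. Qed.
Let g_gt0 : 0 < g. Proof. by rewrite divr_gt0. Qed.
Let g_neq0 : g != 0. Proof. by rewrite gt_eqF. Qed.
Let g_sqr_neq1 : 1 - g ^+ 2 != 0.
Proof.
rewrite subr_eq0 eq_sym sqrf_eq1 negb_or; apply/andP; split.
  apply: contra_notN xy => /eqP h; rewrite -[LHS](divfK y_neq0) h mul1r //.
by apply: contraTneq g_gt0 => ->; rewrite ltr0N1.
Qed.

(** Imaginary part of the moving factor divided by z_1. It gives k_2 = - g b = e. *)
Lemma parallelogram_k2 (a b u v : R) :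
  configuration (Linkage y x x y) (a +i* b, u +i* v) -> a +i* b <> u +i* v ->
  b + v = g * (v * a - u * b).
Proof.
case=> /= ab uv /(parallelogram_factor _ _ _ hx hy _ _ (unit_neq0 _ _ ab) (unit_neq0 _ _ uv)).
case=> // h _.
have : (u +i* v) - (a +i* b)^-1 = (g)%:C * ((u +i* v) / (a +i* b) - 1).
  have := unit_neq0 _ _ ab; move: h; move: (a +i* b) (u +i* v) g%:C => z w t h n.
  by apply: (mulfI n); rewrite mulrBr divff// h; field.
move/unit_coord: ab => ab; rewrite unit_inv//.
by move/(congr1 (@complex.Im R)) => /=; move: g => h'; lra.
Qed.

(** Imaginary part of the moving factor divided by z_1. It gives k_2 = g b = - e. *)
Lemma deltoid2_k2 (a b u v : R) :
  configuration (Linkage x y x y) (a +i* b, u +i* v) -> u +i* v <> -1 ->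
  g * v = (v * a - u * b) + b.
Proof.
case=> /= ab uv /(deltoid2_factor _ _ _ hx hy _ _ (unit_neq0 _ _ ab) (unit_neq0 _ _ uv)).
case=> // h _.
have : (g)%:C * (1 + (u +i* v)) = (u +i* v) / (a +i* b) + (a +i* b).
  have := unit_neq0 _ _ ab; move: h; move: (a +i* b) (u +i* v) g%:C => z w t h n.
  apply: (mulfI n); rewrite [RHS](_ : _ = w + (z * (z - t) + t * z)); last by field.
  by rewrite -h; ring.
move/unit_coord: ab => ab; rewrite unit_inv//.
by move/(congr1 (@complex.Im R)) => /=; move: g => h'; lra.
Qed.

Lemma parallelogram_coefs (S : set (R[i] * R[i])) :
  let L := Linkage y x x y in
  trajectory L z1_neq_z2 S -> F2 L M = 0 ->
  (forall z, S z -> K L M z.1 z.2 = 0) ->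
  [/\ balY L M = 0, bal1 L M = - bal3 L M & bal2 L M = - bal3 L M].
Proof.
move=> L [infS Sc] F20 K0.
pose hE := (hornerXn, hornerD, hornerN, hornerM, hornerZ, hornerC, hornerX).
set Y := balY L M; set B1 := bal1 L M; set B2 := bal2 L M; set B3 := bal3 L M.
pose Q c := exists2 z, S z & c = 0 + g * complex.Re z.1.
(* Since k_2 = e, the terms in 1 and e k_2 merge into p through e k_2 = g^2 - c^2, and those in e
   and k_2 into q. *)
pose p : {poly R} := (2 * Y * (1 - g ^+ 2)) *: ((g ^+ 2)%:P - 'X ^+ 2).
pose q : {poly R} := (B3 - B2) *: 'X + (B2 - B3 * g ^+ 2)%:P -
  (((g ^+ 2)%:P - 'X) * (B2 + B3)%:P + ((1 + g ^+ 2)%:P - 2 *: 'X) * B1%:P).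
have [|||p0 q0] := @quadratic_separation _ Q g p q.
- move=> r rQ; apply: (@poly_Re_eq0 _ _ _ _ _ hy hx hx hy S r 0 g) => //.
  + by split=> // z /Sc[].
  + by case=> e; case: xy.
  + by move=> z Sz; apply: rQ; exists z.
- exact: g_neq0.
- move=> c [[[a b] [u v]] Sz /= ->]; rewrite add0r.
  have [cz nz] := Sc _ Sz.
  have k2E := parallelogram_k2 _ _ _ _ cz nz.
  have [/= e2 _ [P _]] := @angmom_coord _ _ _ _ _ hy M Madm F20 a b u v cz.
  exists (- (g * b)); move: e2 (P (K0 _ Sz)); rewrite divff// -/L -/Y -/B1 -/B2 -/B3.
  have -> : g * (- g * (v * a - u * b) + 1 * v) = - (g * b).
    rewrite [LHS](_ : _ = g * (b + v - g * (v * a - u * b)) - g * b).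
      by rewrite k2E subrr mulr0 add0r.
    by move: g => h; ring.
  rewrite /p /q !hE {P}; clearbody Y B1 B2 B3; move: g => h e2 P.
  have cE : (1 + h ^+ 2 - (- h) ^+ 2 - 1 ^+ 2) / 2 + - (- h * 1) * a = h * a.
    by field.
  have nE : (1 + (- h) ^+ 2 + h ^+ 2 - 1 ^+ 2) / 2 = h ^+ 2 by field.
  have {}e2 : (h * b) ^+ 2 = h ^+ 2 - (h * a) ^+ 2 by move: e2; lra.
  split; first by rewrite sqrrN.
  rewrite -[RHS]P cE nE.
  rewrite [X in _ = _ + X](_ : _ = 2 * Y * (1 - h * a) * (h * b) ^+ 2).
    by rewrite e2; ring.
  by ring.
have ev (r : {poly R}) c : r = 0 -> r.[c] = 0 by move=> ->; rewrite horner0.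
have Y0 : Y = 0.
  have /eqP := ev _ 0 p0; rewrite /p !hE expr0n /= subr0.
  rewrite mulf_eq0 sqrf_eq0 (negPf g_neq0) orbF mulf_eq0 (negPf g_sqr_neq1) orbF.
  by rewrite mulf_eq0 pnatr_eq0 => /eqP.
have q00 := ev _ 0 q0; have q01 := ev _ 1 q0; rewrite /q !hE in q00 q01.
have e1 : B1 = - B3 by lra.
split=> //; apply/eqP; rewrite -addr_eq0; apply/eqP/(mulfI g_sqr_neq1).
by move: q00; rewrite e1; lra.
Qed.

Lemma deltoid2_coefs (S : set (R[i] * R[i])) :
  let L := Linkage x y x y in
  trajectory L z2_neq_N1 S -> F2 L M = 0 ->
  (forall z, S z -> K L M z.1 z.2 = 0) ->
  [/\ balY L M = 0, bal1 L M = - bal2 L M & bal3 L M = - bal2 L M].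
Proof.
move=> L [infS Sc] F20 K0.
pose hE := (hornerXn, hornerD, hornerN, hornerM, hornerZ, hornerC, hornerX).
set Y := balY L M; set B1 := bal1 L M; set B2 := bal2 L M; set B3 := bal3 L M.
pose Q c := exists2 z, S z & c = 0 + g * complex.Re z.1.
(* Now k_2 = - e, which changes the sign of the last two terms. *)
pose p : {poly R} := (- 4 * Y) *: ((1 - 'X) * ((g ^+ 2)%:P - 'X ^+ 2)).
pose q : {poly R} := (B3 - B2) *: 'X + (B2 - B3 * g ^+ 2)%:P +
  ((1 - 'X) * (B2 + B3)%:P + ((1 + g ^+ 2)%:P - 2 *: 'X) * B1%:P).
have [|||p0 q0] := @quadratic_separation _ Q g p q.
- move=> r rQ; apply: (@poly_Re_eq0 _ _ _ _ _ hx hy hx hy S r 0 g) => //.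
  + by split=> // z /Sc[].
  + by case=> e; case: xy.
  + by move=> z Sz; apply: rQ; exists z.
- exact: g_neq0.
- move=> c [[[a b] [u v]] Sz /= ->]; rewrite add0r.
  have [cz nz] := Sc _ Sz.
  have k2E := deltoid2_k2 _ _ _ _ cz nz.
  have [/= e2 _ [P _]] := @angmom_coord _ _ _ _ _ hy M Madm F20 a b u v cz.
  exists (- (g * b)); move: e2 (P (K0 _ Sz)); rewrite divff// -/L -/Y -/B1 -/B2 -/B3.
  have -> : g * (- 1 * (v * a - u * b) + g * v) = g * b.
    by rewrite k2E; move: g => h; ring.
  rewrite /p /q !hE {P}; clearbody Y B1 B2 B3; move: g => h e2 P.
  have cE : (1 + h ^+ 2 - (- 1) ^+ 2 - h ^+ 2) / 2 + - (- 1 * h) * a = h * a.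
    by field.
  have nE : (1 + (- 1) ^+ 2 + h ^+ 2 - h ^+ 2) / 2 = 1 by field.
  have {}e2 : (h * b) ^+ 2 = h ^+ 2 - (h * a) ^+ 2 by move: e2; lra.
  split; first by rewrite sqrrN.
  rewrite -[RHS]P cE nE.
  rewrite [X in _ = _ + X](_ : _ = - (2 * Y * (1 - h * a) * (h * b) ^+ 2)).
    by rewrite e2; ring.
  by ring.
have ev (r : {poly R}) c : r = 0 -> r.[c] = 0 by move=> ->; rewrite horner0.
have Y0 : Y = 0.
  have /eqP := ev _ 0 p0; rewrite /p !hE expr0n /= !subr0 mul1r.
  rewrite mulf_eq0 sqrf_eq0 (negPf g_neq0) orbF mulf_eq0 oppr_eq0 pnatr_eq0.
  by move=> /eqP.
have q00 := ev _ 0 q0; have q01 := ev _ 1 q0; rewrite /q !hE in q00 q01.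
have e1 : B1 = - B2 by lra.
split=> //; apply/eqP; rewrite -addr_eq0; apply/eqP/(mulfI g_sqr_neq1).
by move: q00; rewrite e1; lra.
Qed.

End NontrivialModes.

(** * Trajectories *)

(** Half-angle parametrisation of the unit circle. Taking t = n + 1 > 0 avoids the real axis, so the
    denominators t' + z and 1 + t' z with t' real never vanish, and makes the real part injective in
    n. *)
Definition circle_pt {R : realType} (n : nat) : R[i] :=
  let t : R := n.+1%:R in
  ((1 - t ^+ 2) / (1 + t ^+ 2)) +i* (2 * t / (1 + t ^+ 2)).

Section Circle.
Context (R : realType).
Local Notation w := (@circle_pt R).

Let den_gt0 (t : R) : 0 < 1 + t ^+ 2.
Proof. by rewrite ltr_pwDl// sqr_ge0. Qed.

Lemma circle_pt_unit n : `|w n| = 1.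
Proof.
by apply/unit_coord; have := den_gt0 n.+1%:R; move: n.+1%:R => t d; field; rewrite gt_eqF.
Qed.

Lemma circle_pt_nonreal n : complex.Im (w n) != 0.
Proof. by rewrite mulf_neq0 ?invr_eq0 ?mulf_neq0 ?pnatr_eq0// gt_eqF. Qed.

Lemma circle_pt_neq n (x : R) : w n != x%:C.
Proof. by apply: contra_neq (circle_pt_nonreal n) => ->. Qed.

Lemma circle_pt_inj : injective w.
Proof.
move=> m n /(congr1 (@complex.Re R)) /=.
have e (t : R) : (1 - t ^+ 2) / (1 + t ^+ 2) = 2 / (1 + t ^+ 2) - 1.
  by have := den_gt0 t => d; field; rewrite gt_eqF.
rewrite !e => /addIr /mulfI; rewrite pnatr_eq0 => /(_ isT) /invr_inj /addrI /eqP.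
by rewrite eqrXn2 ?ler0n// eqr_nat eqSS => /eqP.
Qed.

Lemma circle_pt_sqr n : w n ^+ 2 != 1.
Proof.
rewrite sqrf_eq1 negb_or; have := circle_pt_neq n 1; have := circle_pt_neq n (-1).
by rewrite rmorphN rmorph1 => -> ->.
Qed.

(* Since conj(z) = 1/z, we have 1 + t z = z conj(z + t). *)
Lemma norm_reflect (z : R[i]) (t : R) : `|z| = 1 -> `|1 + t%:C * z| = `|z + t%:C|.
Proof.
move=> z1; have n := unit_neq0 _ _ z1.
have -> : 1 + t%:C * z = z * (z + t%:C)^*%C.
  have -> : (z + t%:C)^*%C = z^-1 + t%:C.
    by rewrite -unit_conj//; case: z {z1 n} => a b; apply: complex_ext => /=; ring.
  by rewrite mulrDr divff// mulrC.
by rewrite normrM z1 mul1r normcJ.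
Qed.
End Circle.

Lemma trajectory_range (R : realType) (L : linkage R) mode
    (f : nat -> R[i] * R[i]) : injective f ->
  (forall n, mode_configs L mode (f n)) -> trajectory L mode (range f).
Proof.
move=> fI fc; split; last by move=> _ [n _ <-].
by apply: infinite_image; [exact: in2W|exact: infinite_nat].
Qed.

Section Trajectories.
Context (R : realType) (x y : R) (hx : 0 < x) (hy : 0 < y).
Local Notation g := (x / y).
Local Notation w := (@circle_pt R).

Let wn n (t : R) : w n + t%:C != 0.
Proof. by rewrite addr_eq0 -rmorphN; exact: circle_pt_neq. Qed.

Let w0 n : w n != 0. Proof. exact/unit_neq0/circle_pt_unit. Qed.

Let div_unit (p q : R[i]) : `|p| = `|q| -> q != 0 -> `|p / q| = 1.
Proof. by move=> e q0; rewrite normf_div e divff// normr_eq0. Qed.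

Let rw n (t : R) : 1 + t%:C * w n != 0.
Proof. by rewrite -normr_eq0 norm_reflect ?circle_pt_unit// normr_eq0. Qed.

Lemma parallelogram_trajectory :
  exists S, trajectory (Linkage y x x y) z1_neq_z2 S.
Proof.
(* The moving factor solved for z_2; numerator and denominator have equal modulus by
   [norm_reflect]. *)
pose f n := (w n, (1 + (- g)%:C * w n) / (w n + (- g)%:C)).
have u2 n : `|(f n).2| = 1 by apply: div_unit; rewrite ?norm_reflect ?circle_pt_unit.
exists (range f); apply: trajectory_range => [m n /(congr1 fst)/circle_pt_inj//|n].
split; first split; rewrite ?u2 ?circle_pt_unit//.
  apply/(parallelogram_factor _ _ _ hx hy _ _ (w0 n) (unit_neq0 _ _ (u2 n))).
  right; have := wn n (- g); rewrite /f /= rmorphN /=; move: (w n) g%:C => z t h.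
  by field.
(* z_1 = z_2 would force z_1^2 = 1; the deltoids below reduce to the same contradiction. *)
move=> /= h; have /eqP := circle_pt_sqr R n; apply.
move: h (wn n (- g)); rewrite rmorphN /=; move: (w n) g%:C => z t h n0.
have : z * (z - t) = 1 + - t * z by rewrite {1}h divfK.
by move=> h'; apply/eqP; rewrite -subr_eq0 -(subrr (1 + - t * z)) -{1}h'; apply/eqP; ring.
Qed.

Lemma deltoid1_trajectory :
  exists S, trajectory (Linkage x x y y) z1_neq_1 S.
Proof.
pose f n := (w n * ((w n + g%:C) / (1 + g%:C * w n)), w n).
have u1 n : `|(f n).1| = 1.
  by rewrite normrM circle_pt_unit mul1r div_unit// norm_reflect ?circle_pt_unit.
exists (range f); apply: trajectory_range => [m n /(congr1 snd)/circle_pt_inj//|n].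
split; first split; rewrite ?u1 ?circle_pt_unit//.
  apply/(deltoid1_factor _ _ _ hx hy _ _ (unit_neq0 _ _ (u1 n)) (w0 n)).
  by right; have := rw n g; rewrite /f /=; move: (w n) g%:C => z t h; field.
move=> /= h; have /eqP := circle_pt_sqr R n; apply.
move: h (rw n g); move: (w n) g%:C => z t h n0.
have : z * (z + t) = 1 + t * z.
  by rewrite -[RHS]mul1r -[X in _ = X * _]h mulrA divfK.
by move=> h'; apply/eqP; rewrite -subr_eq0 -(subrr (1 + t * z)) -{1}h'; apply/eqP; ring.
Qed.

Lemma deltoid2_trajectory :
  exists S, trajectory (Linkage x y x y) z2_neq_N1 S.
Proof.
pose f n := (w n, - (w n * ((w n + (- g)%:C) / (1 + (- g)%:C * w n)))).
have u2 n : `|(f n).2| = 1.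
  by rewrite normrN normrM circle_pt_unit mul1r div_unit// norm_reflect ?circle_pt_unit.
exists (range f); apply: trajectory_range => [m n /(congr1 fst)/circle_pt_inj//|n].
split; first split; rewrite ?u2 ?circle_pt_unit//.
  apply/(deltoid2_factor _ _ _ hx hy _ _ (w0 n) (unit_neq0 _ _ (u2 n))).
  right; have := rw n (- g); rewrite /f /= rmorphN /=; move: (w n) g%:C => z t h.
  by field.
move=> /= h; have /eqP := circle_pt_sqr R n; apply.
move: h (rw n (- g)); rewrite rmorphN /=; move: (w n) g%:C => z t /oppr_inj h n0.
have : z * (z - t) = 1 + - t * z.
  by rewrite -[RHS]mul1r -[X in _ = X * _]h mulrA divfK.
by move=> h'; apply/eqP; rewrite -subr_eq0 -(subrr (1 + - t * z)) -{1}h'; apply/eqP; ring.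
Qed.

Lemma parallel_trajectory : trajectory (Linkage y x x y) z1_eq_z2 (range (fun n => (w n, w n))).
Proof.
apply: trajectory_range => [m n /(congr1 fst)/circle_pt_inj//|n]; split=> //.
split; rewrite ?circle_pt_unit//.
by apply/(parallelogram_factor _ _ _ hx hy _ _ (w0 n) (w0 n)); left.
Qed.

Lemma fold1_trajectory : trajectory (Linkage x x y y) z1_eq_1 (range (fun n => (1, w n))).
Proof.
apply: trajectory_range => [m n /(congr1 snd)/circle_pt_inj//|n]; split=> //.
split; rewrite ?normr1 ?circle_pt_unit//.
by apply/(deltoid1_factor _ _ _ hx hy _ _ (oner_neq0 _) (w0 n)); left.
Qed.

Lemma fold2_trajectory : trajectory (Linkage x y x y) z2_eq_N1 (range (fun n => (w n, -1))).
Proof.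
apply: trajectory_range => [m n /(congr1 fst)/circle_pt_inj//|n]; split=> //.
split; rewrite ?normrN1 ?circle_pt_unit//; have n1 : (-1 : R[i]) != 0 by rewrite oppr_eq0 oner_neq0.
by apply/(deltoid2_factor _ _ _ hx hy _ _ (w0 n) n1); left.
Qed.
End Trajectories.

(** * Degenerate modes *)

(** Away from 1 and -1 the affine function itself vanishes. Multiplied by f, with conj(f) = 1 / f,
    it is a quadratic in f whose middle coefficient is al: a line meets the circle in at most two
    points. *)
Lemma affine_circle_cst_eq0 (R : realType) (T : Type) (S : set T)
    (f : T -> R[i]) (al be ga : R) : infinite_set S ->
  (forall r, finite_set (S `&` f @^-1` [set r])) ->
  (forall z, S z -> `|f z| = 1) ->
  (forall z, S z -> complex.Im (f z)
     * (al + be * complex.Re (f z) + ga * complex.Im (f z)) = 0) -> al = 0.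
Proof.
move=> infS fin fu h.
pose S' := S `\` ((S `&` f @^-1` [set 1]) `|` (S `&` f @^-1` [set -1])).
have infS' : infinite_set S'.
  by apply: infinite_setD => //; rewrite finite_setU.
have [|r|_ al0 _] := @quadratic_eq0 _ _ S' f ((be / 2) +i* (- ga / 2)) al%:C
    ((be / 2) +i* (ga / 2)) infS'.
- move=> z [Sz ne]; move: (h z Sz) (fu z Sz) ne => /[swap].
  case fz: (f z) => [a b] /unit_coord ab1 /= hz ne.
  have b0 : b != 0.
    apply: contra_notN ne => /eqP b0; move: ab1; rewrite b0 expr0n addr0 => /eqP.
    rewrite sqrf_eq1 => /orP[]/eqP a1; [left|right]; split=> //=.
      by rewrite fz a1 b0.
    by rewrite fz a1 b0; apply: complex_ext => //=; rewrite oppr0.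
  move/eqP: hz; rewrite mulf_eq0 (negPf b0) /= => /eqP hz.
  rewrite expr2; apply: complex_ext => /=.
    transitivity (a * (al + be * a + ga * b) - be / 2 * (a ^+ 2 + b ^+ 2 - 1)).
      by field.
    by rewrite hz ab1 subrr !mulr0 subrr.
  transitivity (b * (al + be * a + ga * b) - ga / 2 * (a ^+ 2 + b ^+ 2 - 1)).
    by field.
  by rewrite hz ab1 subrr !mulr0 subrr.
- by apply: sub_finite_set (fin r) => z [[Sz _] fz].
by move/(congr1 (@complex.Re R)): al0.
Qed.

Section TrivialModes.
Context (R : realType) (x y : R) (hx : 0 < x) (hy : 0 < y).

Let g_neq0 : x / y != 0. Proof. by rewrite gt_eqF// divr_gt0. Qed.
Let yy1 : y / y = 1. Proof. by rewrite divff// gt_eqF. Qed.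

Let dir3 (M : masses R) : admissible M ->
  complex.Re (dir (link3 M)) ^+ 2 + complex.Im (dir (link3 M)) ^+ 2 = 1.
Proof. by case=> _ _ [_ _ _]; case: (dir _) => p q /unit_coord. Qed.

(** The coupler only translates. Up to a factor Im z_1 the angular momentum is affine in Re z_1 and
    Im z_1, with constant term J_1 + J_2 + m_3 l_1^2 > 0. *)
Lemma no_dynamic_parallel : ~ dynamic_balancing_possible (Linkage y x x y) z1_eq_z2.
Proof.
case=> M [Madm [S [[infS Sc] [_ K0]]]].
case: (Madm) => /Jmom_gt0 J1 /Jmom_gt0 J2 [m3 _ _ _].
set X2 := mass (link2 M) * offset (link2 M) * complex.Re (dir (link2 M)).
set Y2 := mass (link2 M) * offset (link2 M) * complex.Im (dir (link2 M)).
set X := mass (link3 M) * offset (link3 M) * complex.Re (dir (link3 M)).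
set Y := mass (link3 M) * offset (link3 M) * complex.Im (dir (link3 M)).
suff : Jmom (link1 M) + Jmom (link2 M) + mass (link3 M) * x ^+ 2 = 0.
  by have := mulr_gt0 m3 (exprn_gt0 2 hx); lra.
apply: (@affine_circle_cst_eq0 _ _ S fst _ (x * X + y * X2) (x * Y - y * Y2) infS).
- move=> r; apply: (@sub_finite_set _ _ [set (r, r)]); last exact: finite_set1.
  by move=> [a b] [/Sc[_ e] /= ar]; have {}e : a = b := e; rewrite -e ar.
- by move=> z /Sc[[]].
move=> [z1 z2] Sz; have [[/= u1 _ _] e] := Sc _ Sz.
have {}e : z1 = z2 := e; rewrite -e in Sz.
have := K0 _ Sz; move: u1 {Sz e}; case: z1 => a b /unit_coord ab /=.
rewrite K_coord// K3_coord ?K4_coord ?dir3//= yy1 -/X -/Y -/X2 -/Y2.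
move: (x / y) g_neq0 (Jmom _) (Jmom _) (Jmom _) => g g0 JJ1 JJ2 JJ3 h.
apply: (mulfI g0); rewrite mulr0 -[RHS]oppr0 -h.
have ab' : a * a + b * b = 1 by rewrite -!expr2.
by rewrite ab'; ring.
Qed.

(** Link 1 lies on the base and z_3 = z_2, so links 2 and 3 turn together; the constant term is J_2
    + J_3. *)
Lemma no_dynamic_fold1 : ~ dynamic_balancing_possible (Linkage x x y y) z1_eq_1.
Proof.
case=> M [Madm [S [[infS Sc] [_ K0]]]].
case: (Madm) => _ /Jmom_gt0 J2 /Jmom_gt0 J3.
set X2 := mass (link2 M) * offset (link2 M) * complex.Re (dir (link2 M)).
set Y2 := mass (link2 M) * offset (link2 M) * complex.Im (dir (link2 M)).
set X := mass (link3 M) * offset (link3 M) * complex.Re (dir (link3 M)).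
set Y := mass (link3 M) * offset (link3 M) * complex.Im (dir (link3 M)).
suff : Jmom (link2 M) + Jmom (link3 M) = 0 by lra.
apply: (@affine_circle_cst_eq0 _ _ S snd _ (x * X + x * X2) (- x * Y - x * Y2) infS).
- by move=> r; apply: (@finite_fst_snd _ _ _ 1) => z /Sc[].
- by move=> z /Sc[[]].
move=> [z1 z2] Sz; have [[/= _ u2 _] e] := Sc _ Sz.
have {}e : z1 = 1 := e; rewrite e in Sz.
have := K0 _ Sz; move: u2 {Sz e}; case: z2 => u v /unit_coord uv /=.
have one : (1 : R) ^+ 2 + 0 ^+ 2 = 1 by rewrite expr0n addr0 expr1n.
rewrite -[X in K _ _ X]/((1 : R) +i* (0 : R)).
rewrite K_coord// K3_coord ?K4_coord ?dir3//= yy1 -/X -/Y -/X2 -/Y2.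
move: (x / y) g_neq0 (Jmom _) (Jmom _) (Jmom _) => g g0 JJ1 JJ2 JJ3 h.
by apply: (mulfI g0); rewrite mulr0 -h; ring.
Qed.

(** Link 2 lies on the base and z_3 = - z_1, so links 1 and 3 turn about the origin as one rigid
    body. *)
Lemma no_dynamic_fold2 : ~ dynamic_balancing_possible (Linkage x y x y) z2_eq_N1.
Proof.
case=> M [Madm [S [[infS Sc] [_ K0]]]].
have d3 := dir3 M Madm.
case: (Madm) => /Jmom_gt0 J1 _ [m3 I3 r3 _].
set X := mass (link3 M) * offset (link3 M) * complex.Re (dir (link3 M)).
(* This is J_1 + I_3 + m_3 |l_1 - r_3 p_3|^2 expanded, hence positive. *)
suff : Jmom (link1 M) + mass (link3 M) * y ^+ 2 - 2 * y * X + Jmom (link3 M) = 0.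
  rewrite {2}/Jmom /X; move: d3; move: (complex.Re _) (complex.Im _) => p q d3.
  move: (mass _) (offset _) (inertia _) m3 I3 => m r I m0 I0.
  have : 0 <= m * ((y - r * p) ^+ 2 + (r * q) ^+ 2).
    by rewrite mulr_ge0 ?addr_ge0 ?sqr_ge0 ?ltW.
  rewrite (_ : _ * _ = m * y ^+ 2 - 2 * y * (m * r * p)
    + m * r ^+ 2 * (p ^+ 2 + q ^+ 2)); last by ring.
  by rewrite d3 mulr1; lra.
apply: (@affine_circle_cst_eq0 _ _ S fst _ 0 0 infS).
- by move=> r; apply: (@finite_snd_fst _ _ _ _ (-1)) => z /Sc[].
- by move=> z /Sc[[]].
move=> [z1 z2] Sz; have [[/= u1 _ _] e] := Sc _ Sz.
have {}e : z2 = -1 := e; rewrite e in Sz.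
have := K0 _ Sz; move: u1 {Sz e}; case: z1 => a b /unit_coord ab /=.
have one : (-1 : R) ^+ 2 + 0 ^+ 2 = 1 by rewrite expr0n addr0 sqrrN expr1n.
have -> : (-1 : R[i]) = (-1 : R) +i* 0 by apply: complex_ext => //=; rewrite oppr0.
rewrite K_coord// K3_coord ?K4_coord ?dir3//= yy1 -/X.
move: (x / y) g_neq0 (Jmom _) (Jmom _) (Jmom _) => g g0 JJ1 JJ2 JJ3 h.
by apply: (mulfI g0); rewrite mulr0 -[RHS]h; ring.
Qed.
End TrivialModes.

(** * Dynamic balancing *)

Lemma lt_sqrt2M (R : rcfType) (x y : R) : 0 < x -> 0 < y ->
  (Num.sqrt 2 * x < y) = (2 * x ^+ 2 < y ^+ 2).
Proof.
move=> x0 y0; rewrite -(@ltr_pXn2r _ 2)// ?nnegrE ?mulr_ge0 ?sqrtr_ge0 ?ltW//.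
by rewrite exprMn sqr_sqrtr.
Qed.

(** Put X = m xi, with xi the coordinate of the coupler's centre of mass along the coupler, and s =
    x^2 / y. Dropping j1, j2 > 0 and using m xi^2 < j3 leaves (xi - y) (xi - s) < 0 and xi^2 < (y -
    s) xi, so s < xi < y - s. *)
Lemma parallelogram_ineq (R : realFieldType) (x y m j1 j2 j3 X : R) :
  0 < x -> 0 < y -> 0 < m -> 0 < j1 -> 0 < j2 -> X ^+ 2 < m * j3 ->
  j1 + m * x ^+ 2 - (x / y) ^+ 2 * (y * X) = - (j3 - y * X) ->
  j2 + (x / y) ^+ 2 * (y * X) = - (j3 - y * X) -> 2 * x ^+ 2 < y ^+ 2.
Proof.
move=> hx hy m0 j10 j20 j3X.
have -> : (x / y) ^+ 2 * (y * X) = x ^+ 2 / y * X by field; rewrite gt_eqF.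
have [s sE] : exists s : R, x ^+ 2 / y = s by eexists.
rewrite sE => h1 h2.
have [xi XE] : exists xi, X = m * xi by exists (X / m); rewrite mulrC divfK// gt_eqF.
have s0 : 0 < s by rewrite -sE divr_gt0 ?exprn_gt0.
have {sE} xys : x ^+ 2 = s * y by rewrite -sE divfK// gt_eqF.
have a1 : m * (xi ^+ 2) < j3.
  by rewrite -(ltr_pM2l m0) (_ : m * (m * xi ^+ 2) = X ^+ 2)// XE; ring.
have a2 : xi ^+ 2 + x ^+ 2 < (y + s) * xi.
  have : m * (xi ^+ 2 + x ^+ 2) < m * ((y + s) * xi) by move: h1; rewrite XE; lra.
  by rewrite ltr_pM2l.
have a3 : xi ^+ 2 < (y - s) * xi.
  have : m * (xi ^+ 2) < m * ((y - s) * xi) by move: h2; rewrite XE; lra.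
  by rewrite ltr_pM2l.
have b1 : (xi - y) * (xi - s) < 0 by rewrite xys in a2; lra.
have xi0 : 0 < xi.
  have [//|xi0] := ltP 0 xi.
  have : 0 <= (y - xi) * (s - xi) by rewrite mulr_ge0// subr_ge0 (le_trans xi0)// ltW.
  by lra.
have b2 : xi < y - s by rewrite -(ltr_pM2r xi0) -expr2.
have b3 : s < xi.
  have [//|xs] := ltP s xi.
  have : 0 <= (y - xi) * (s - xi) by rewrite mulr_ge0// subr_ge0; lra.
  by lra.
have b4 : 2 * s < y by lra.
by rewrite xys expr2 mulrA ltr_pM2r.
Qed.

(** With xi and s as before, the equations give y < s, xi < s and s y = x^2 < (s - y) xi, hence s y
    < (s - y) s. *)
Lemma deltoid1_ineq (R : realFieldType) (x y m j1 j2 j3 X : R) :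
  0 < x -> 0 < y -> 0 < m -> 0 < j1 -> 0 < j2 -> X ^+ 2 < m * j3 ->
  j1 + m * x ^+ 2 - (x / y) ^+ 2 * (y * X) = - (j3 - y * X) ->
  j2 + y * X = j3 - y * X -> 2 * y ^+ 2 < x ^+ 2.
Proof.
move=> hx hy m0 j10 j20 j3X.
have -> : (x / y) ^+ 2 * (y * X) = x ^+ 2 / y * X by field; rewrite gt_eqF.
have [s sE] : exists s : R, x ^+ 2 / y = s by eexists.
rewrite sE => h1 h2.
have [xi XE] : exists xi, X = m * xi by exists (X / m); rewrite mulrC divfK// gt_eqF.
have s0 : 0 < s by rewrite -sE divr_gt0 ?exprn_gt0.
have {sE} xys : x ^+ 2 = s * y by rewrite -sE divfK// gt_eqF.
have a1 : m * (xi ^+ 2) < j3.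
  by rewrite -(ltr_pM2l m0) (_ : m * (m * xi ^+ 2) = X ^+ 2)// XE; ring.
have a2 : xi ^+ 2 + x ^+ 2 < (y + s) * xi.
  have : m * (xi ^+ 2 + x ^+ 2) < m * ((y + s) * xi) by move: h1; rewrite XE; lra.
  by rewrite ltr_pM2l.
have a3 : x ^+ 2 < (s - y) * xi.
  have : m * (x ^+ 2) < m * ((s - y) * xi) by move: h1 h2; rewrite XE; lra.
  by rewrite ltr_pM2l.
have b1 : (xi - y) * (xi - s) < 0 by rewrite xys in a2; lra.
have xi0 : 0 < xi.
  have [//|xi0] := ltP 0 xi.
  have : 0 <= (y - xi) * (s - xi) by rewrite mulr_ge0// subr_ge0 (le_trans xi0)// ltW.
  by lra.
have ys : y < s.
  have [//|sy] := ltP y s.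
  have : 0 <= (y - s) * xi by rewrite mulr_ge0 ?subr_ge0// ltW.
  by have := exprn_gt0 2 hx; lra.
have b3 : xi < s.
  have [//|xs] := ltP xi s.
  have : 0 <= (xi - y) * (xi - s) by rewrite mulr_ge0// subr_ge0; lra.
  by lra.
have b4 : (s - y) * xi < (s - y) * s by rewrite ltr_pM2l ?subr_gt0.
have b5 : s * y < s * (s - y) by rewrite -xys (lt_trans a3)// mulrC; lra.
have b6 : 2 * y < s by move: b5; rewrite ltr_pM2l//; lra.
by rewrite xys expr2 mulrA ltr_pM2r.
Qed.

(** With xi and s as before, y^2 and xi^2 are both less than (s - y) (- xi). So |xi| < |s - y| and
    y^2 < (s - y)^2, which for s > 0 means 2 y < s. *)
Lemma deltoid2_ineq (R : realFieldType) (x y m j1 j2 j3 X : R) :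
  0 < x -> 0 < y -> 0 < m -> 0 < j1 -> 0 < j2 -> X ^+ 2 < m * j3 ->
  j1 + m * y ^+ 2 - y * X = - (j2 + (x / y) ^+ 2 * (y * X)) ->
  j3 - y * X = - (j2 + (x / y) ^+ 2 * (y * X)) -> 2 * y ^+ 2 < x ^+ 2.
Proof.
move=> hx hy m0 j10 j20 j3X.
have -> : (x / y) ^+ 2 * (y * X) = x ^+ 2 / y * X by field; rewrite gt_eqF.
have [s sE] : exists s : R, x ^+ 2 / y = s by eexists.
rewrite sE => h1 h2.
have [xi XE] : exists xi, X = m * xi by exists (X / m); rewrite mulrC divfK// gt_eqF.
have s0 : 0 < s by rewrite -sE divr_gt0 ?exprn_gt0.
have {sE} xys : x ^+ 2 = s * y by rewrite -sE divfK// gt_eqF.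
have a1 : m * (xi ^+ 2) < j3.
  by rewrite -(ltr_pM2l m0) (_ : m * (m * xi ^+ 2) = X ^+ 2)// XE; ring.
have a2 : y ^+ 2 < (s - y) * - xi.
  have : m * (y ^+ 2) < m * ((s - y) * - xi) by move: h1; rewrite XE; lra.
  by rewrite ltr_pM2l.
have a3 : xi ^+ 2 < (s - y) * - xi.
  have : m * (xi ^+ 2) < m * ((s - y) * - xi) by move: h2; rewrite XE; lra.
  by rewrite ltr_pM2l.
have b6 : 2 * y < s.
  have [xi0|xi0] := leP 0 xi.
    have sy : s < y.
      have [//|sy] := ltP s y.
      have : 0 <= (s - y) * xi by rewrite mulr_ge0// subr_ge0.
      by have := exprn_gt0 2 hy; lra.
    have : xi < y.
      have [//|yx] := ltP xi y.
      have : 0 <= (xi - (y - s)) * xi by rewrite mulr_ge0//; lra.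
      by lra.
    move=> xy; have : 0 <= s * xi by rewrite mulr_ge0// ltW.
    have : 0 < y * (y - xi) by rewrite mulr_gt0// subr_gt0.
    by lra.
  have [//|sy] := ltP (2 * y) s.
  have c1 : - xi < s - y.
    have [//|c] := ltP (- xi) (s - y).
    have : 0 <= (- xi - (s - y)) * - xi by rewrite mulr_ge0 ?subr_ge0//; lra.
    by lra.
  have : 0 <= (y - (s - y)) * - xi by rewrite mulr_ge0//; lra.
  have : 0 < y * (y + xi) by rewrite mulr_gt0//; lra.
  by lra.
by rewrite xys expr2 mulrA ltr_pM2r.
Qed.

(** m J = m I + (m r)^2, and I > 0 makes the bound strict. *)
Lemma moment_re_sqr_lt (R : realType) (p : link_mass R) : admissible_link p ->
  moment_re p ^+ 2 < mass p * Jmom p.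
Proof.
case: p => m i r [a b] [/= m0 i0 r0 /unit_coord ab]; rewrite /moment_re /Jmom /=.
rewrite -subr_gt0 (_ : _ - _ = m * i + (m * r) ^+ 2 * (1 - a ^+ 2)); last by ring.
rewrite -ab addrAC subrr add0r ltr_pwDl ?mulr_gt0//.
by rewrite mulr_ge0 ?sqr_ge0.
Qed.

(** * The rhombus *)

Lemma rhombus_modes (R : realType) (x : R) (z : R[i] * R[i]) : 0 < x ->
  configuration (Linkage x x x x) z -> [\/ z.1 = z.2, z.1 = 1 | z.2 = -1].
Proof.
move=> x0; case: z => z1 z2 [/= /unit_neq0 n1 /unit_neq0 n2].
move/(parallelogram_factor _ _ _ x0 x0 _ _ n1 n2) => [->|]; first by constructor 1.
rewrite divff ?gt_eqF// rmorph1 mul1r => h.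
have /eqP : (z1 - 1) * (z2 + 1) = 0.
  by rewrite (_ : _ * _ = z1 * z2 - 1 - (z2 - z1)); [rewrite h subrr|ring].
by rewrite mulf_eq0 subr_eq0 addr_eq0 => /orP[]/eqP ->; [constructor 2|constructor 3].
Qed.

(** An infinite S meets one of the three degenerate components in an infinite set, and each of them
    has been ruled out. In the criteria below both sides are therefore false when x = y. *)
Lemma no_dynamic_rhombus (R : realType) (x : R) (mode : set (R[i] * R[i])) :
  0 < x -> ~ dynamic_balancing_possible (Linkage x x x x) mode.
Proof.
move=> x0 [M [Madm [S [[infS Sc] [[c st] K0]]]]].
have sub mode' : infinite_set (S `&` mode') ->
    dynamic_balancing_possible (Linkage x x x x) mode'.
  move=> inf; exists M; split=> //; exists (S `&` mode'); split.
    by split=> // z [/Sc[]].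
  by split; [exists c => z [/st]|move=> z [/K0]].
have [fin1|/sub] := pselect (finite_set (S `&` z1_eq_z2)); last exact: no_dynamic_parallel.
have [fin2|/sub] := pselect (finite_set (S `&` z1_eq_1)); last exact: no_dynamic_fold1.
have [fin3|/sub] := pselect (finite_set (S `&` z2_eq_N1)); last exact: no_dynamic_fold2.
apply: infS; apply: (@sub_finite_set _ _
  ((S `&` z1_eq_z2) `|` (S `&` z1_eq_1) `|` (S `&` z2_eq_N1))).
  move=> z Sz; have [cz _] := Sc _ Sz.
  by case: (rhombus_modes _ _ _ x0 cz) => h; [left; left|left; right|right].
by rewrite !finite_setU.
Qed.


(** * Sufficiency of the balance equations *)

Lemma diag_neq0 (R : realFieldType) (g a b : R) : 0 < g -> g != 1 ->
  a ^+ 2 + b ^+ 2 = 1 -> 1 + g ^+ 2 - 2 * (g * a) != 0.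
Proof.
move=> g0 g1 ab; rewrite gt_eqF//.
(* The squared diagonal is (1 - g)^2 + g |1 - z_1|^2. *)
rewrite (_ : _ - _ = (1 - g) ^+ 2 + g * (1 - 2 * a + (a ^+ 2 + b ^+ 2))).
  rewrite ltr_pwDl//.
    by rewrite lt_def sqr_ge0 sqrf_eq0 subr_eq0 eq_sym g1.
  apply: mulr_ge0; first exact: ltW.
  by rewrite (_ : _ + _ = (1 - a) ^+ 2 + b ^+ 2) ?addr_ge0 ?sqr_ge0//; ring.
by rewrite ab; ring.
Qed.

Lemma parallelogram_angmom0 (R : realType) (x y : R) (M : masses R) z :
  let L := Linkage y x x y in 0 < x -> 0 < y -> x <> y -> admissible M ->
  F2 L M = 0 -> balY L M = 0 -> bal1 L M = - bal3 L M ->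
  bal2 L M = - bal3 L M -> mode_configs L z1_neq_z2 z -> K L M z.1 z.2 = 0.
Proof.
move=> /= hx hy xy Madm F20 Y0 B13 B23 [cz nz]; move: z cz nz => [[a b] [u v]] cz nz.
have k2E := parallelogram_k2 _ _ _ hx hy _ _ _ _ cz nz.
have [/= _ _ [_]] := @angmom_coord _ _ _ _ _ hy M Madm F20 a b u v cz.
have yy : y / y = 1 by rewrite divff ?gt_eqF.
rewrite yy Y0 B13 B23.
have [/= /unit_coord ab _ _] := cz.
have g0 : 0 < x / y by rewrite divr_gt0.
have g1 : x / y != 1.
  by apply/eqP => h; apply: xy; rewrite -[LHS](@divfK _ y) ?gt_eqF// h mul1r.
have bt := diag_neq0 _ _ _ _ g0 g1 ab.
have -> : x / y * (- (x / y) * (v * a - u * b) + 1 * v) = - (x / y * b).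
  rewrite [LHS](_ : _ = x / y * (b + v - x / y * (v * a - u * b)) - x / y * b).
    by rewrite k2E subrr mulr0 add0r.
  by move: (x / y) => h; ring.
move: (x / y) (bal3 _ M) bt => h B bt.
have -> : (1 + h ^+ 2 - (- h) ^+ 2 - 1 ^+ 2) / 2 + - (- h * 1) * a = h * a.
  by field.
have -> : (1 + (- h) ^+ 2 + h ^+ 2 - 1 ^+ 2) / 2 = h ^+ 2 by field.
by apply=> //; ring.
Qed.

(** Here D = g (1 - z_1), so the diagonal is nonzero precisely in this mode. *)
Lemma deltoid1_angmom0 (R : realType) (x y : R) (M : masses R) z :
  let L := Linkage x x y y in 0 < x -> 0 < y -> admissible M ->
  F2 L M = 0 -> balY L M = 0 -> bal1 L M = - bal3 L M ->
  bal2 L M = bal3 L M -> mode_configs L z1_neq_1 z -> K L M z.1 z.2 = 0.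
Proof.
move=> /= hx hy Madm F20 Y0 B13 B23 [cz nz]; move: z cz nz => [[a b] [u v]] cz nz.
have [/= _ _ [_]] := @angmom_coord _ _ _ _ _ hy M Madm F20 a b u v cz.
have yy : y / y = 1 by rewrite divff ?gt_eqF.
rewrite yy Y0 B13 B23.
have [/= /unit_coord ab _ _] := cz.
have g0 : x / y != 0 by rewrite gt_eqF// divr_gt0.
have a1 : a != 1.
  apply/eqP => a1; apply: nz; move/eqP: ab => /=.
  rewrite a1 expr1n -subr_eq0 addrAC subrr add0r sqrf_eq0 => /eqP ->.
  exact: complex_ext.
move: (x / y) g0 (bal3 _ M) => h h0 B.
have cE : (1 + 1 ^+ 2 - (- h) ^+ 2 - h ^+ 2) / 2 + - (- h * h) * a
  = 1 - h ^+ 2 * (1 - a) by field.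
apply; rewrite cE.
  rewrite (_ : _ - _ = 2 * (h ^+ 2 * (1 - a))); last by ring.
  by rewrite !mulf_neq0 ?expf_neq0 ?pnatr_eq0// subr_eq0 eq_sym.
by field.
Qed.

Lemma deltoid2_angmom0 (R : realType) (x y : R) (M : masses R) z :
  let L := Linkage x y x y in 0 < x -> 0 < y -> x <> y -> admissible M ->
  F2 L M = 0 -> balY L M = 0 -> bal1 L M = - bal2 L M ->
  bal3 L M = - bal2 L M -> mode_configs L z2_neq_N1 z -> K L M z.1 z.2 = 0.
Proof.
move=> /= hx hy xy Madm F20 Y0 B12 B32 [cz nz]; move: z cz nz => [[a b] [u v]] cz nz.
have k2E := deltoid2_k2 _ _ _ hx hy _ _ _ _ cz nz.
have [/= _ _ [_]] := @angmom_coord _ _ _ _ _ hy M Madm F20 a b u v cz.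
have yy : y / y = 1 by rewrite divff ?gt_eqF.
rewrite yy Y0 B12 B32.
have [/= /unit_coord ab _ _] := cz.
have g0 : 0 < x / y by rewrite divr_gt0.
have g1 : x / y != 1.
  by apply/eqP => h; apply: xy; rewrite -[LHS](@divfK _ y) ?gt_eqF// h mul1r.
have bt := diag_neq0 _ _ _ _ g0 g1 ab.
have -> : x / y * (- 1 * (v * a - u * b) + x / y * v) = x / y * b.
  by rewrite k2E; move: (x / y) => h; ring.
move: (x / y) (bal2 _ M) bt => h B bt.
have -> : (1 + h ^+ 2 - (- 1) ^+ 2 - h ^+ 2) / 2 + - (- 1 * h) * a = h * a.
  by field.
have -> : (1 + (- 1) ^+ 2 + h ^+ 2 - h ^+ 2) / 2 = 1 by field.
by apply=> //; ring.
Qed.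

Lemma trajectoryT (R : realType) (L : linkage R) mode S :
  trajectory L mode S -> trajectory L setT S.
Proof. by case=> infS Sc; split=> // z /Sc[]. Qed.

Lemma parallelogram_static (R : realType) (x y : R) (A B c : R[i]) S :
  0 < x -> 0 < y -> x <> y -> trajectory (Linkage y x x y) z1_neq_z2 S ->
  (forall z, S z -> A * z.1 + B * z.2 = c) -> A = 0 /\ B = 0.
Proof.
move=> hx hy xy tS h.
have [|[_ _ _ e]|[e _ _ _]|[e _ _ _]] :=
  static_linear_relation _ _ _ _ _ hy hx hx hy A B c S (trajectoryT _ _ _ _ tS) h => //.
case: tS => infS Sc; have [z Sz] := infinite_setN0 infS.
by have [_] := Sc z Sz; case; exact: e.
Qed.

Lemma deltoid1_static (R : realType) (x y : R) (A B c : R[i]) S :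
  0 < x -> 0 < y -> x <> y -> trajectory (Linkage x x y y) z1_neq_1 S ->
  (forall z, S z -> A * z.1 + B * z.2 = c) -> A = 0 /\ B = 0.
Proof.
move=> hx hy xy tS h.
have [|[e _ _ _]|[_ _ _ e]|[e _ _ _]] :=
  static_linear_relation _ _ _ _ _ hx hx hy hy A B c S (trajectoryT _ _ _ _ tS) h => //.
  case: tS => infS Sc; have [z Sz] := infinite_setN0 infS.
  by have [_] := Sc z Sz; case; exact: e.
by case: xy.
Qed.

Lemma deltoid2_static (R : realType) (x y : R) (A B c : R[i]) S :
  0 < x -> 0 < y -> x <> y -> trajectory (Linkage x y x y) z2_neq_N1 S ->
  (forall z, S z -> A * z.1 + B * z.2 = c) -> A = 0 /\ B = 0.
Proof.
move=> hx hy xy tS h.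
have [|[e _ _ _]|[e _ _ _]|[_ _ _ e]] :=
  static_linear_relation _ _ _ _ _ hx hy hx hy A B c S (trajectoryT _ _ _ _ tS) h => //.
- by case: xy.
- by case: xy.
case: tS => infS Sc; have [z Sz] := infinite_setN0 infS.
by have [_] := Sc z Sz; case; exact: e.
Qed.

(** * Criteria for dynamic balancing and explicit masses *)

Lemma parallelogram_dynamicP (R : realType) (x y : R) : 0 < x -> 0 < y ->
  dynamic_balancing_possible (Linkage y x x y) z1_neq_z2 <-> Num.sqrt 2 * x < y.
Proof.
move=> hx hy; rewrite lt_sqrt2M//; split.
  have [-> /no_dynamic_rhombus //|/eqP xy] := eqVneq x y.
  case=> M [Madm [S [tS [[c st] K0]]]].
  have [F10 F20] := parallelogram_static _ _ _ _ _ _ _ hx hy xy tS st.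
  have [_ B1 B2] := parallelogram_coefs _ _ _ hx hy xy _ Madm _ tS F20 K0.
  case: (Madm) => /Jmom_gt0 j1 /Jmom_gt0 j2 a3; have X3 := moment_re_sqr_lt _ _ a3.
  case: a3 => m3 _ _ _.
  exact: parallelogram_ineq hx hy m3 j1 j2 X3 B1 B2.
move=> xy2; pose D := y ^+ 2 - 2 * x ^+ 2; have D0 : 0 < D by rewrite subr_gt0.
(* xi = y / 2 is the midpoint of the interval s < xi < y - s of [parallelogram_ineq]. F_1 = F_2 = 0
   then fixes m r = x / 2 with direction -1 for links 1 and 2, and the balance equations become I_3
   + J_1 = I_3 + J_2 = D / 4, solved by D / 12 + D / 6. *)
pose M := Masses
  (LinkMass (3 * x ^+ 2 / D) (D / 12) (D / (6 * x)) (-1))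
  (LinkMass (3 * x ^+ 2 / D) (D / 12) (D / (6 * x)) (-1))
  (LinkMass 1 (D / 12) (y / 2) (1 : R[i])).
have Madm : admissible M.
  by split; split; rewrite /= ?normrN1 ?normr1// ?divr_ge0 ?divr_gt0
    ?mulr_gt0 ?exprn_gt0// ?ltW ?mulr_gt0.
have nz : (x != 0) * (y != 0) * (D != 0) by rewrite !gt_eqF.
have F10 : F1 (Linkage y x x y) M = 0.
  rewrite F1_coord /moment_re /moment_im; apply: complex_ext => /=; first by field; rewrite !nz.
  by rewrite oppr0 !mulr0 subrr.
have F20 : F2 (Linkage y x x y) M = 0.
  rewrite F2_coord /moment_re /moment_im; apply: complex_ext => /=; first by field; rewrite !nz.
  by rewrite oppr0 !mulr0 addr0.
have [S tS] := parallelogram_trajectory _ _ _ hx hy.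
exists M; split=> //; exists S; split=> //; split.
  by exists 0 => z _; rewrite F10 F20 !mul0r addr0.
have xy : x <> y by move=> e; have := exprn_gt0 2 hx; move: xy2; rewrite e; lra.
move=> z /tS.2; apply: parallelogram_angmom0 => //.
- by rewrite /balY /moment_im /= !mulr0.
- rewrite /bal1 /bal3 /Jmom /moment_re /=; rewrite /D in nz *.
  by field; rewrite !nz.
- rewrite /bal2 /bal3 /Jmom /moment_re /=; rewrite /D in nz *.
  by field; rewrite !nz.
Qed.

Lemma deltoid1_dynamicP (R : realType) (x y : R) : 0 < x -> 0 < y ->
  dynamic_balancing_possible (Linkage x x y y) z1_neq_1 <-> Num.sqrt 2 * y < x.
Proof.
move=> hx hy; rewrite lt_sqrt2M//; split.
  have [-> /no_dynamic_rhombus //|/eqP xy] := eqVneq x y.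
  case=> M [Madm [S [tS [[c st] K0]]]].
  have [F10 F20] := deltoid1_static _ _ _ _ _ _ _ hx hy xy tS st.
  have [|||_ B1 B2 _ _] := angmom_coefs _ _ _ _ _ hx hx hy hy M Madm F20 S
    (trajectoryT _ _ _ _ tS) K0.
  - by move=> _ z /tS.2[].
  - by case.
  - by case=> e; case: xy.
  case: (Madm) => /Jmom_gt0 j1 /Jmom_gt0 j2 a3; have X3 := moment_re_sqr_lt _ _ a3.
  case: a3 => m3 _ _ _.
  have yy : y / y = 1 by rewrite divff// gt_eqF.
  apply: deltoid1_ineq hx hy m3 j1 j2 X3 B1 _.
  by move: B2; rewrite /bal2 /= yy expr1n mul1r.
move=> xy2; pose D := x ^+ 2 - 2 * y ^+ 2; have D0 : 0 < D by rewrite subr_gt0.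
(* xi = 2 y is the value forced in the limit x^2 = 2 y^2. Static balance then fixes the moments x
   and - 2 y of links 1 and 2, and the balance equations become J_2 = I_3 and J_1 + I_3 = D; all
   three are D / 2. *)
pose M := Masses
  (LinkMass (4 * x ^+ 2 / D) (D / 4) (D / (4 * x)) (1 : R[i]))
  (LinkMass (16 * y ^+ 2 / D) (D / 4) (D / (8 * y)) (-1))
  (LinkMass 1 (D / 2) (2 * y) (1 : R[i])).
have Madm : admissible M.
  by split; split; rewrite /= ?normrN1 ?normr1// ?divr_ge0 ?divr_gt0
    ?mulr_gt0 ?exprn_gt0// ?ltW ?mulr_gt0.
have nz : (x != 0) * (y != 0) * (D != 0) by rewrite !gt_eqF.
have F10 : F1 (Linkage x x y y) M = 0.
  rewrite F1_coord /moment_re /moment_im; apply: complex_ext => /=; first by field; rewrite !nz.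
  by rewrite !mulr0 subrr.
have F20 : F2 (Linkage x x y y) M = 0.
  rewrite F2_coord /moment_re /moment_im; apply: complex_ext => /=; first by field; rewrite !nz.
  by rewrite oppr0 !mulr0 addr0.
have [S tS] := deltoid1_trajectory _ _ _ hx hy.
exists M; split=> //; exists S; split=> //; split.
  by exists 0 => z _; rewrite F10 F20 !mul0r addr0.
move=> z /tS.2; apply: deltoid1_angmom0 => //.
- by rewrite /balY /moment_im /= !mulr0.
- rewrite /bal1 /bal3 /Jmom /moment_re /=; rewrite /D in nz *.
  by field; rewrite !nz.
- rewrite /bal2 /bal3 /Jmom /moment_re /=; rewrite /D in nz *.
  by field; rewrite !nz.
Qed.

Lemma deltoid2_dynamicP (R : realType) (x y : R) : 0 < x -> 0 < y ->
  dynamic_balancing_possible (Linkage x y x y) z2_neq_N1 <-> Num.sqrt 2 * y < x.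
Proof.
move=> hx hy; rewrite lt_sqrt2M//; split.
  have [-> /no_dynamic_rhombus //|/eqP xy] := eqVneq x y.
  case=> M [Madm [S [tS [[c st] K0]]]].
  have [F10 F20] := deltoid2_static _ _ _ _ _ _ _ hx hy xy tS st.
  have [_ B1 B3] := deltoid2_coefs _ _ _ hx hy xy _ Madm _ tS F20 K0.
  case: (Madm) => /Jmom_gt0 j1 /Jmom_gt0 j2 a3; have X3 := moment_re_sqr_lt _ _ a3.
  case: a3 => m3 _ _ _.
  have yy : y / y = 1 by rewrite divff// gt_eqF.
  apply: deltoid2_ineq hx hy m3 j1 j2 X3 _ B3.
  by move: B1; rewrite /bal1 /= yy expr1n mul1r.
move=> xy2; pose D := x ^+ 2 - 2 * y ^+ 2; have D0 : 0 < D by rewrite subr_gt0.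
(* xi = - y is again the value forced in the limit. The moments of links 1 and 2 are - 2 y and x,
   and the balance equations become J_1 + J_2 = I_3 + J_2 = D. *)
pose M := Masses
  (LinkMass (16 * y ^+ 2 / D) (D / 4) (D / (8 * y)) (-1))
  (LinkMass (4 * x ^+ 2 / D) (D / 4) (D / (4 * x)) (1 : R[i]))
  (LinkMass 1 (D / 2) y (-1)).
have Madm : admissible M.
  by split; split; rewrite /= ?normrN1 ?normr1// ?divr_ge0 ?divr_gt0
    ?mulr_gt0 ?exprn_gt0// ?ltW ?mulr_gt0.
have nz : (x != 0) * (y != 0) * (D != 0) by rewrite !gt_eqF.
have F10 : F1 (Linkage x y x y) M = 0.
  rewrite F1_coord /moment_re /moment_im; apply: complex_ext => /=; first by field; rewrite !nz.
  by rewrite oppr0 !mulr0 subrr.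
have F20 : F2 (Linkage x y x y) M = 0.
  rewrite F2_coord /moment_re /moment_im; apply: complex_ext => /=; first by field; rewrite !nz.
  by rewrite oppr0 !mulr0 addr0.
have [S tS] := deltoid2_trajectory _ _ _ hx hy.
exists M; split=> //; exists S; split=> //; split.
  by exists 0 => z _; rewrite F10 F20 !mul0r addr0.
have xy : x <> y by move=> e; have := exprn_gt0 2 hx; move: xy2; rewrite e; lra.
move=> z /tS.2; apply: deltoid2_angmom0 => //.
- by rewrite /balY /moment_im /= oppr0 !mulr0.
- rewrite /bal1 /bal2 /Jmom /moment_re /=; rewrite /D in nz *.
  by field; rewrite !nz.
- rewrite /bal3 /bal2 /Jmom /moment_re /=; rewrite /D in nz *.
  by field; rewrite !nz.
Qed.

(** * Static conditions in each mode *)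

Lemma balanced_on0 (R : realType) (L : linkage R) (M : masses R) S :
  F1 L M = 0 /\ F2 L M = 0 -> statically_balanced_on L M S.
Proof. by case=> F10 F20; exists 0 => z _; rewrite F10 F20 !mul0r addr0. Qed.

(** The set of all configurations of the mode is itself a trajectory, since it contains one; this
    settles the second equivalence. *)
Lemma static_mode_iff (R : realType) (L : linkage R) (M : masses R) mode :
  (exists S, trajectory L mode S) ->
  (forall S, trajectory L mode S -> statically_balanced_on L M S ->
     F1 L M = 0 /\ F2 L M = 0) ->
  (statically_balanced L M mode <-> F1 L M = 0 /\ F2 L M = 0) /\
  (statically_balanced_on L M (mode_configs L mode) <->
     F1 L M = 0 /\ F2 L M = 0).
Proof.
move=> [S tS] h; split; split; try exact: balanced_on0.
- by case=> S' [tS' st]; exact: h st.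
- by move=> F0; exists S; split=> //; exact: balanced_on0.
apply: h; split=> //; case: tS => infS Sc.
exact: sub_infinite_set infS.
Qed.

Lemma circle_affine_eq0 (R : realType) (A k c : R[i]) :
  (forall n, A * circle_pt n + k = c) -> A = 0.
Proof.
move=> h; apply/eqP; have := h 0%N; rewrite -(h 1%N) => /addIr /eqP.
rewrite -subr_eq0 -mulrBr mulf_eq0 subr_eq0 => /orP[//|/eqP].
by move/circle_pt_inj.
Qed.

Section RhombusStatic.
Context (R : realType) (x : R) (hx : 0 < x) (M : masses R).
Local Notation L := (Linkage x x x x).

Let conf_eq n : configuration L (circle_pt n, circle_pt n).
Proof. by have [_ /(_ _ (imageP _ (I : setT n)))[]] := parallel_trajectory _ _ _ hx hx. Qed.

Let conf_1 n : configuration L (1, circle_pt n).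
Proof. by have [_ /(_ _ (imageP _ (I : setT n)))[]] := fold1_trajectory _ _ _ hx hx. Qed.

Let conf_N1 n : configuration L (circle_pt n, -1).
Proof. by have [_ /(_ _ (imageP _ (I : setT n)))[]] := fold2_trajectory _ _ _ hx hx. Qed.

Let pt1 n : @circle_pt R n <> 1.
Proof. by apply/eqP; exact: (circle_pt_neq R n 1). Qed.

Let ptN1 n : @circle_pt R n <> -1.
Proof. by apply/eqP; have := circle_pt_neq R n (-1); rewrite rmorphN rmorph1. Qed.

(** The mode contains both z_2 = -1, where z_1 moves alone and forces F_1 = 0, and z_1 = 1, where
    z_2 moves alone and forces F_2 = 0. *)
Lemma rhombus_static_z1_neq_z2 :
  statically_balanced_on L M (mode_configs L z1_neq_z2) ->
  F1 L M = 0 /\ F2 L M = 0.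
Proof.
case=> c h; split.
  apply: (@circle_affine_eq0 _ _ (F2 L M * -1) c) => n.
  by apply: (h (circle_pt n, -1)); split=> //; exact: ptN1.
apply: (@circle_affine_eq0 _ _ (F1 L M * 1) c) => n; rewrite addrC.
by apply: (h (1, circle_pt n)); split=> // /esym; exact: pt1.
Qed.

Lemma rhombus_static_z1_neq_1 :
  statically_balanced_on L M (mode_configs L z1_neq_1) ->
  F1 L M = 0 /\ F2 L M = 0.
Proof.
case=> c h; have F10 : F1 L M = 0.
  apply: (@circle_affine_eq0 _ _ (F2 L M * -1) c) => n.
  by apply: (h (circle_pt n, -1)); split=> //; exact: pt1.
split=> //; apply: (@circle_affine_eq0 _ _ 0 c) => n.
have <- : F1 L M * circle_pt n + F2 L M * circle_pt n = c.
  by apply: (h (circle_pt n, circle_pt n)); split=> //; exact: pt1.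
by rewrite F10 mul0r add0r addr0.
Qed.

Lemma rhombus_static_z2_neq_N1 :
  statically_balanced_on L M (mode_configs L z2_neq_N1) ->
  F1 L M = 0 /\ F2 L M = 0.
Proof.
case=> c h; have F20 : F2 L M = 0.
  apply: (@circle_affine_eq0 _ _ (F1 L M * 1) c) => n; rewrite addrC.
  by apply: (h (1, circle_pt n)); split=> //; exact: ptN1.
split=> //; apply: (@circle_affine_eq0 _ _ 0 c) => n.
have <- : F1 L M * circle_pt n + F2 L M * circle_pt n = c.
  by apply: (h (circle_pt n, circle_pt n)); split=> //; exact: ptN1.
by rewrite F20 mul0r.
Qed.
End RhombusStatic.

Section TrivialStatic.
Context (R : realType) (x y : R) (hx : 0 < x) (hy : 0 < y) (M : masses R).

Lemma parallel_static : let L := Linkage y x x y in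
  statically_balanced L M z1_eq_z2 <-> F1 L M + F2 L M = 0.
Proof.
move=> L; split=> [[S [[infS Sc] [c st]]]|F0]; last first.
  exists (range (fun n => (circle_pt n, circle_pt n))).
  split; first exact: parallel_trajectory.
  by exists 0 => _ [n _ <-] /=; rewrite -mulrDl F0 mul0r.
apply: contrapT => /eqP F0; apply: infS; set k := c / (F1 L M + F2 L M).
apply: (@sub_finite_set _ _ [set (k, k)]); last exact: finite_set1.
move=> [a b] Sz; have [_ e] := Sc _ Sz; have {}e : a = b := e.
rewrite -e in Sz *.
by have := st _ Sz; rewrite /= -mulrDl /k => <-; rewrite mulrC mulKf.
Qed.

Lemma fold1_static : let L := Linkage x x y y in
  statically_balanced L M z1_eq_1 <-> F2 L M = 0.
Proof.
move=> L; split=> [[S [[infS Sc] [c st]]]|F0]; last first.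
  exists (range (fun n => (1, circle_pt n))); split; first exact: fold1_trajectory.
  by exists (F1 L M) => _ [n _ <-] /=; rewrite F0 mul0r addr0 mulr1.
apply: contrapT => /eqP F0; apply: infS; set k := (c - F1 L M) / F2 L M.
apply: (@sub_finite_set _ _ [set (1, k)]); last exact: finite_set1.
move=> [a b] Sz; have [_ e] := Sc _ Sz; have {}e : a = 1 := e.
rewrite e in Sz *.
by have := st _ Sz; rewrite /= mulr1 /k => <-; rewrite addrC addKr mulrC mulKf.
Qed.

Lemma fold2_static : let L := Linkage x y x y in
  statically_balanced L M z2_eq_N1 <-> F1 L M = 0.
Proof.
move=> L; split=> [[S [[infS Sc] [c st]]]|F0]; last first.
  exists (range (fun n => (circle_pt n, -1))); split; first exact: fold2_trajectory.
  by exists (- F2 L M) => _ [n _ <-] /=; rewrite F0 mul0r add0r mulrN1.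
apply: contrapT => /eqP F0; apply: infS; set k := (c + F2 L M) / F1 L M.
apply: (@sub_finite_set _ _ [set (k, -1)]); last exact: finite_set1.
move=> [a b] Sz; have [_ e] := Sc _ Sz; have {}e : b = -1 := e.
rewrite e in Sz *.
by have := st _ Sz; rewrite /= mulrN1 /k => <-; rewrite subrK mulrC mulKf.
Qed.
End TrivialStatic.

(** For a rhombus, balance on some infinite S is weaker than F_1 = F_2 = 0: in the mode z_1 <> z_2,
    for instance, S may lie in z_1 = 1, where F_2 = 0 suffices. That equivalence is therefore stated
    off the rhombus, next to the one for all configurations of the mode, which holds always. *)
Theorem mainTheorem1 (R : realType) (d l1 l2 l3 : R)
    (hd : 0 < d) (hl1 : 0 < l1) (hl2 : 0 < l2) (hl3 : 0 < l3) :
  let L := Linkage d l1 l2 l3 in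
  (l1 = l2 /\ l3 = d ->
    [/\ ~ rhombus L -> forall M : masses R, admissible M ->
          (statically_balanced L M z1_neq_z2 <-> F1 L M = 0 /\ F2 L M = 0),
        forall M : masses R, admissible M ->
          (statically_balanced_on L M (mode_configs L z1_neq_z2) <->
           F1 L M = 0 /\ F2 L M = 0),
        dynamic_balancing_possible L z1_neq_z2 <-> d > Num.sqrt 2 * l2,
        forall M : masses R, admissible M ->
          (statically_balanced L M z1_eq_z2 <-> F1 L M + F2 L M = 0)
      & ~ dynamic_balancing_possible L z1_eq_z2])
  /\
  (l1 = d /\ l2 = l3 ->
    [/\ ~ rhombus L -> forall M : masses R, admissible M ->
          (statically_balanced L M z1_neq_1 <-> F1 L M = 0 /\ F2 L M = 0),
        forall M : masses R, admissible M ->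
          (statically_balanced_on L M (mode_configs L z1_neq_1) <->
           F1 L M = 0 /\ F2 L M = 0),
        dynamic_balancing_possible L z1_neq_1 <-> d > Num.sqrt 2 * l3,
        forall M : masses R, admissible M ->
          (statically_balanced L M z1_eq_1 <-> F2 L M = 0)
      & ~ dynamic_balancing_possible L z1_eq_1])
  /\
  (l2 = d /\ l1 = l3 ->
    [/\ ~ rhombus L -> forall M : masses R, admissible M ->
          (statically_balanced L M z2_neq_N1 <-> F1 L M = 0 /\ F2 L M = 0),
        forall M : masses R, admissible M ->
          (statically_balanced_on L M (mode_configs L z2_neq_N1) <->
           F1 L M = 0 /\ F2 L M = 0),
        dynamic_balancing_possible L z2_neq_N1 <-> d > Num.sqrt 2 * l3,
        forall M : masses R, admissible M ->
          (statically_balanced L M z2_eq_N1 <-> F1 L M = 0)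
      & ~ dynamic_balancing_possible L z2_eq_N1])
  /\
  (~ (l1 = l2 /\ l3 = d) -> ~ (l1 = d /\ l2 = l3) -> ~ (l2 = d /\ l1 = l3) ->
    (forall M : masses R, admissible M -> forall S : set (R[i] * R[i]),
       trajectory L setT S ->
       (statically_balanced_on L M S <-> F1 L M = 0 /\ F2 L M = 0))
    /\ ~ dynamic_balancing_possible L setT).
Proof.
move=> L; rewrite {}/L; split; [|split; [|split]].
- case=> e1 e3; rewrite e1 e3 {e1 e3 hl1 hl3}.
  have iff (M : masses R) := static_mode_iff _ _ M _ (parallelogram_trajectory _ _ _ hl2 hd).
  have gen M S : l2 <> d -> trajectory _ _ S -> statically_balanced_on _ M S -> _ :=
    fun xy tS => fun '(ex_intro c st) => parallelogram_static _ _ _ _ _ c _ hl2 hd xy tS st.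
  split.
  + move=> nr M _; apply: (iff M _).1 => S; apply: gen => e; apply: nr.
    by rewrite /rhombus /= e.
  + move=> M _; have [e|/eqP ne] := eqVneq l2 d; last by apply: (iff M _).2 => S; exact: gen.
    rewrite -e; split; [exact: rhombus_static_z1_neq_z2 | exact: balanced_on0].
  + exact: parallelogram_dynamicP.
  + by move=> M _; exact: parallel_static.
  + exact: no_dynamic_parallel.
- case=> e1 e2; rewrite e1 e2 {e1 e2 hl1 hl2}.
  have iff (M : masses R) := static_mode_iff _ _ M _ (deltoid1_trajectory _ _ _ hd hl3).
  have gen M S : d <> l3 -> trajectory _ _ S -> statically_balanced_on _ M S -> _ :=
    fun xy tS => fun '(ex_intro c st) => deltoid1_static _ _ _ _ _ c _ hd hl3 xy tS st.
  split.
  + move=> nr M _; apply: (iff M _).1 => S; apply: gen => e; apply: nr.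
    by rewrite /rhombus /= e.
  + move=> M _; have [e|/eqP ne] := eqVneq d l3; last by apply: (iff M _).2 => S; exact: gen.
    rewrite -e; split; [exact: rhombus_static_z1_neq_1 | exact: balanced_on0].
  + exact: deltoid1_dynamicP.
  + by move=> M _; exact: fold1_static.
  + exact: no_dynamic_fold1.
- case=> e1 e2; rewrite e1 e2 {e1 e2 hl1 hl2}.
  have iff (M : masses R) := static_mode_iff _ _ M _ (deltoid2_trajectory _ _ _ hd hl3).
  have gen M S : d <> l3 -> trajectory _ _ S -> statically_balanced_on _ M S -> _ :=
    fun xy tS => fun '(ex_intro c st) => deltoid2_static _ _ _ _ _ c _ hd hl3 xy tS st.
  split.
  + move=> nr M _; apply: (iff M _).1 => S; apply: gen => e; apply: nr.
    by rewrite /rhombus /= e.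
  + move=> M _; have [e|/eqP ne] := eqVneq d l3; last by apply: (iff M _).2 => S; exact: gen.
    rewrite -e; split; [exact: rhombus_static_z2_neq_N1 | exact: balanced_on0].
  + exact: deltoid2_dynamicP.
  + by move=> M _; exact: fold2_static.
  + exact: no_dynamic_fold2.
move=> n1 n2 n3.
have stat M S : trajectory (Linkage d l1 l2 l3) setT S ->
    statically_balanced_on (Linkage d l1 l2 l3) M S ->
    F1 (Linkage d l1 l2 l3) M = 0 /\ F2 (Linkage d l1 l2 l3) M = 0.
  move=> tS [c st].
  have [//|[? ? _ _]|[? ? _ _]|[? ? _ _]] :=
    static_linear_relation _ _ _ _ _ hd hl1 hl2 hl3 _ _ c S tS st.
  - by case: n1.
  - by case: n2.
  - by case: n3.
split=> [M _ S tS|]; first by split; [exact: stat|exact: balanced_on0].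
case=> M [Madm [S [tS [st K0]]]]; have [F10 F20] := stat M S tS st.
have [//|//|//|_ B1 B23 B2 B13] :=
  angmom_coefs _ _ _ _ _ hd hl1 hl2 hl3 M Madm F20 S tS K0.
(* B_2 = B_3 and one of them is positive, so the last two conditions of [angmom_coefs] reduce to l_2
   = l_3 and l_1 = d, the excluded deltoid. *)
have b3 : bal3 (Linkage d l1 l2 l3) M != 0.
  by case: (bal2_or_bal3_gt0 _ d l1 _ _ hl2 hl3 M Madm);
    rewrite ?B23 lt0r => /andP[].
have sqr_inj u v : 0 < u -> 0 < v -> (u / l3) ^+ 2 = (v / l3) ^+ 2 -> u = v.
  move=> u0 v0 /eqP; rewrite eqrXn2 ?ltW ?divr_gt0// => /eqP.
  exact: (ratio_eq _ _ hl3).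
apply: n2; split; apply: sqr_inj => //.
  by move/eqP: B13; rewrite mulf_eq0 (negPf b3) sqrrN subr_eq0 => /eqP.
move/eqP: B2; rewrite mulf_eq0 (negPf b3) subr_eq0 => /eqP <-.
by rewrite divff ?expr1n// gt_eqF.
Qed.
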